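(* Fix $\delta\in(0,1/2)$ and $0<\alpha_0<\alpha_1$. Let $p,n\in\mathbb{N}$ and set $$\tau_{\text{dense}}^2(p,s,n,\alpha):=s\left(\frac{ns}{\sqrt{p\log\log(np)}}\right)^{-\frac{4\alpha}{4\alpha+1}}.$$ If $\eta\in(0,1)$, then there exists $c_\eta>0$ depending only on $\eta$ such that for all $0<c<c_\eta$ we have $$\inf_\varphi\left\{P_0\{\varphi\ne0\}+\max_{p^{1/2+\delta}\le s\le p}\ \sup_{\alpha\in[\alpha_0,\alpha_1]}\ \sup_{\substack{f\in\mathcal{F}(s,\alpha),\\ \|f\|_2\ge c\,\tau_{\text{dense}}(p,s,n,\alpha)}}P_f\{\varphi\ne1\}\right\}\ge1-\eta.$$
   Context: Model: one observes the $p$-dimensional Gaussian white noise model $dY_x = f(x)\,dx + \frac{1}{\sqrt n}\,dB_x$, $x\in[0,1]^p$. $P_f$ denotes the law of the observation when the signal is $f$, and $P_0$ the law when $f\equiv 0$. The infimum is over all tests $\varphi$, i.e. measurable functions of the observation with values in $\{0,1\}$. $\|\cdot\|_2$ is the $L^2([0,1]^p)$ norm. $s$ ranges over integers in $[p]=\{1,\dots,p\}$. Parameter space: $\{\psi_k\}_{k\ge1}\subset L^2([0,1])$ is a fixed (known) orthonormal system of functions orthogonal to constants, which does not depend on $\alpha\in[\alpha_0,\alpha_1]$. For $\alpha>0$ and $s\in[p]$, $$\mathscr{T}(s,\alpha):=\left\{\Theta=(\theta_{k,j})\in\mathbb{R}^{\mathbb{N}\times p}:\ \sum_{j=1}^p\mathbbm{1}_{\{\Theta_j\ne0\}}\le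 s,\ \ \sum_{k=1}^\infty\frac{\theta_{k,j}^2}{k^{-2\alpha}}\le1\text{ for all }j\right\},$$ where $\Theta_j$ is the $j$th column of $\Theta$, and $\mathcal{F}(s,\alpha)$ is the corresponding set of functions $f(x)=\sum_{j=1}^p\sum_{k\ge1}\theta_{k,j}\psi_k(x_j)$ with $\Theta\in\mathscr{T}(s,\alpha)$. Thus $\|f\|_2^2=\sum_{j}\sum_k\theta_{k,j}^2$. Convention: iterated logarithms such as $\log\log(np)$ are understood to be equal to a universal constant whenever the expression would otherwise be less than one. *)

(* Defs.v *)
From HB Require Import structures.
From mathcomp Require Import all_boot all_order all_algebra.
From mathcomp Require Import all_classical all_reals all_analysis.

Set Implicit Arguments.
Unset Strict Implicit.
Unset Printing Implicit Defensive.
Import Order.TTheory GRing.Theory Num.Theory.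
Import numFieldNormedType.Exports.

Local Open Scope classical_set_scope.
Local Open Scope ring_scope.

Section product_probability.
Context d1 d2 (T1 : measurableType d1) (T2 : measurableType d2) (R : realType).
Variables (P1 : probability T1 R) (P2 : probability T2 R).

Definition product_prob : set (T1 * T2) -> \bar R := (P1 \x P2)%E.

HB.instance Definition _ := Measure.on product_prob.

Let product_prob_setT : product_prob [set: T1 * T2] = 1%E.
Proof.
rewrite /product_prob -setXTT [LHS]product_measure1E//.
by rewrite [X in (X * _)%E]probability_setT [X in (_ * X)%E]probability_setT mule1.
Qed.

HB.instance Definition _ :=
  Measure_isProbability.Build _ _ _ product_prob product_prob_setT.
End product_probability.

Section tuple_cons.
Context d (T : measurableType d) (p : nat).

Definition tuple_cons (x : T * p.-tuple T) : p.+1.-tuple T :=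
  [the p.+1.-tuple T of x.1 :: x.2].

Let measurable_tuple_cons : measurable_fun [set: T * p.-tuple T] tuple_cons.
Proof. exact: measurable_cons. Qed.

HB.instance Definition _ :=
  isMeasurableFun.Build _ _ _ _ tuple_cons measurable_tuple_cons.
End tuple_cons.

(* Functions on [0,1] and [0,1]^p are represented by functions on R and
   p.-tuple R; the Lebesgue measures of the interval and of the cube do not
   charge the complement, where the values are therefore irrelevant. *)
Definition leb1 (R : realType) : probability (measurableTypeR R) R :=
  uniform_prob (@ltr01 R).

Fixpoint leb_cube (R : realType) (p : nat) :
    probability (p.-tuple (measurableTypeR R)) R :=
  match p with
  | 0 => \d_([tuple] : 0.-tuple (measurableTypeR R))
  | q.+1 => distribution (product_prob (leb1 R) (leb_cube R q))
                         (@tuple_cons _ (measurableTypeR R) q)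
  end.

Section L2.
Context d (T : measurableType d) (R : realType).
Variable mu : {measure set T -> \bar R}.

(* Functions, not classes of almost everywhere equal functions. *)
Definition L2 : Type := LfunType mu (lee1n 2).

Definition inner (f g : T -> R) : R := \int[mu]_x (f x * g x).

Definition norm2 (f : T -> R) : \bar R := ('N[mu]_2%:E[EFin \o f])%E.
End L2.

(* psi k stands for psi_(k+1), here and in the classes below. *)
Definition orthonormal_centered (R : realType) (psi : nat -> L2 (leb1 R)) :=
  (forall k l, inner (leb1 R) (psi k) (psi l) = (k == l)%:R) /\
  (forall k, \int[leb1 R]_x psi k x = 0).

Section classes.
Variables (R : realType) (p : nat).

(* The rows are shifted: Theta k j stands for theta_(k+1, j). *)
Definition coef_class (s : nat) (alpha : R) : set (nat -> 'I_p -> R) :=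
  [set Theta : nat -> 'I_p -> R |
     (#|[set j : 'I_p | `[< exists k, Theta k j != 0%R >]]| <= s)%N /\
     forall j, (\sum_(0 <= k <oo)
       (Theta k j ^+ 2 / (k.+1%:R `^ (- 2 * alpha)))%:E <= 1)%E].

(* The series defining f converges in L^2([0,1]^p). *)
Definition fun_class (psi : nat -> L2 (leb1 R)) (s : nat) (alpha : R) :
    set (L2 (leb_cube R p)) :=
  [set f | exists2 Theta, coef_class s alpha Theta &
     norm2 (leb_cube R p) (fun x =>
       f x - \sum_(j < p) \sum_(0 <= k < N) Theta k j * psi k (tnth x j))
     @[N --> \oo] --> 0%E].
End classes.

Section white_noise.
Context d (Omega : measurableType d) (R : realType) (P : probability Omega R).

(* normal_prob is parametrized by the standard deviation and is a junk
   distribution when that is 0. *)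
Definition gaussian (X : Omega -> R) :=
  exists m v : R, 0 <= v /\
    forall A : set R, measurable A ->
      P (X @^-1` A) = if v == 0 then \d_m A else normal_prob m (Num.sqrt v) A.

(* W g is the Wiener integral of g against dB: a centered Gaussian process
   indexed by L^2([0,1]^p) with covariance the inner product. *)
Definition is_white_noise (p : nat) (W : L2 (leb_cube R p) -> {RV P >-> R}) :=
  [/\ forall (m : nat) (a : 'I_m -> R) (g : 'I_m -> L2 (leb_cube R p)),
        gaussian (fun w => \sum_(i < m) a i * W (g i) w),
      forall g, ('E_P[W g] = 0)%E &
      forall g h, covariance P (W g) (W h) = (inner (leb_cube R p) g h)%:E].
End white_noise.

Section observation.
Variables (R : realType) (p : nat).

(* A realization y of the observation is the family of its integrals
   y g = \int g dY, measurable for the cylinder sigma-algebra. *)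
Definition cylinders : set (set (L2 (leb_cube R p) -> R)) :=
  [set C | exists (g : L2 (leb_cube R p)) (A : set R),
     measurable A /\ C = [set y | A (y g)]].

Definition obs : Type := g_sigma_algebraType cylinders.

HB.instance Definition _ := Measurable.on obs.

Context d (Omega : measurableType d) (P : probability Omega R).
Variables (W : L2 (leb_cube R p) -> {RV P >-> R}) (n : nat).

(* \int g dY = \int g f dx + n^(-1/2) \int g dB *)
Definition observe (f : L2 (leb_cube R p)) (w : Omega) : obs :=
  fun g => inner (leb_cube R p) g f + (Num.sqrt n%:R)^-1 * W g w.

Let measurable_observe f : measurable_fun [set: Omega] (observe f).
Proof.
apply: (@measurability _ _ Omega obs [set: Omega] (observe f) cylinders erefl).
move=> _ [_ [g [A [mA ->]]] <-].
have mY : measurable_fun [set: Omega] (fun w =>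
  inner (leb_cube R p) g f + (Num.sqrt n%:R)^-1 * W g w).
  apply: measurable_realfun.measurable_funD => //.
  exact: measurable_realfun.measurable_funM.
exact: mY.
Qed.

HB.instance Definition _ f :=
  isMeasurableFun.Build _ _ _ _ (observe f) (measurable_observe f).

Definition law (f : L2 (leb_cube R p)) : probability obs R :=
  distribution P (observe f).

End observation.

(* Iterated logarithm, set to the universal constant C when below one; as ln is 0
   on nonpositive reals, this covers the arguments where it is undefined. *)
Definition loglog (R : realType) (C x : R) : R :=
  if ln (ln x) < 1 then C else ln (ln x).

Section rate.
Variables (R : realType) (C : R) (p s n : nat) (alpha : R).

Definition tau_dense_sq : R :=
  s%:R * ((n%:R * s%:R) / Num.sqrt (p%:R * loglog C (n * p)%N%:R))
           `^ (- (4 * alpha / (4 * alpha + 1))).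

Definition tau_dense : R := Num.sqrt tau_dense_sq.
End rate.

Section testing.
Variables (R : realType) (C : R) (p n : nat) (psi : nat -> L2 (leb1 R)).
Context d (Omega : measurableType d) (P : probability Omega R).
Variable W : L2 (leb_cube R p) -> {RV P >-> R}.

Definition null_signal : L2 (leb_cube R p) := 0.

(* The values 0 and 1 of a test are false and true. *)
Definition test : Type := {mfun obs R p >-> bool}.

(* An empty signal class contributes -oo to the suprema. *)
Definition risk (delta alpha0 alpha1 c : R) (phi : test) : \bar R :=
  (law W n null_signal [set y | phi y <> false] +
   ereal_sup [set
     ereal_sup [set
       ereal_sup [set law W n f [set y | phi y <> true] | f in
         [set f | fun_class psi s alpha f /\
            (c * tau_dense C p s n alpha)%:E <= norm2 (leb_cube R p) f]]
     | alpha in [set` `[alpha0, alpha1]]]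
   | s in [set s : nat | [/\ (1 <= s <= p)%N &
                             (p%:R `^ (2^-1 + delta) <= s%:R)%R]]])%E.

Definition minimax_risk (delta alpha0 alpha1 c : R) : \bar R :=
  ereal_inf [set risk delta alpha0 alpha1 c phi | phi in [set: test]].
End testing.

(* Main.v *)
From HB Require Import structures.
Require Import Defs.
From mathcomp Require Import all_boot all_order all_algebra.
From mathcomp Require Import all_classical all_reals all_analysis.
From mathcomp Require Import measurable_realfun ring lra zify.

Set Implicit Arguments.
Unset Strict Implicit.
Unset Printing Implicit Defensive.
Import Order.TTheory GRing.Theory Num.Theory.
Import numFieldNormedType.Exports.
Local Open Scope classical_set_scope.
Local Open Scope ring_scope.

(** The bound is obtained by testing the null signal against a mixture of
    signals that all have full sparsity [s = p], so that only the smoothness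
    varies. Put [N = n p / sqrt (p L)], with [L] the iterated logarithm of
    [n p]. At scale [m], the [4 ^ m] first coefficients of each of the [p]
    components are independent random signs times [r_m], where
    [r_m ^ 2 = a / (N 2 ^ m)] and [a] is a small constant. Such a signal belongs
    to the class of smoothness [alpha] and is as large as the rate demands as
    soon as [2 ^ (m (4 alpha + 1))] is comparable to [N]
    ([prior_signal_class], [prior_signal_norm]). When [alpha] runs through its
    interval, the admissible [m] form an interval too, whose number of points
    [M] is of the order of [ln N], hence of [ln (n p)] ([adaptive_scales]);
    when this number stays bounded, a single scale is enough.

    The chi-square distance of the mixture to the null is the average, over two
    independent draws [f] and [f'] of the prior, of [expR (n <f, f'>)], minus
    one. For draws of scales [m] and [m'], [<f, f'>] is a sum of independent
    signs, and averaging over them costs at most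
    [expR (2 a ^ 2 L / 2 ^ |m - m'|)] ([sum_expR_random_coef]). Distant scales
    are thus almost orthogonal, and by convexity of the exponential the average
    over all pairs of scales exceeds one by at most
    [3 (expR (2 a ^ 2 L) - 1) / M]. As [expR L <= G M], a second use of convexity
    bounds this by [6 a ^ 2 G] ([prior_chi2]), which is small with [a]: the
    iterated logarithm is exactly what the number of scales can absorb, and no
    asymptotics in [n] or [p] is involved.

    The passage from the chi-square distance to the risk
    ([mixture_testing_bound]) requires the likelihood ratio of a shifted white
    noise ([cameron_martin]), while the noise is only known through the normality
    of its finite linear combinations. In the noise [W], replace the component
    along [f] by an independent copy [Z]: the resulting process has the same law
    ([resampledE]), and on it both the shift of the signal by [f] and the
    exponential weight act on [Z] alone, so that the formula reduces to the
    translation of a standard normal law ([ge0_integral_normal01_shift]).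
    Equality of laws on the cylinder sigma-algebra follows from equality in law
    of all finite linear combinations ([obs_law_unique]); this is the Cramer-Wold
    principle, obtained here by approximating the indicators of
    half-lines with polynomials in waves [cos (<t, x> + b)], whose expectations
    only involve these combinations ([rays_indistinct]). *)

(** * Densities and affine changes of variable *)

Section density.
Context d (T : measurableType d) (R : realType).
Variables (mu nu : {measure set T -> \bar R}) (h : T -> R).
Hypotheses (mh : measurable_fun [set: T] h) (h0 : forall x, 0 <= h x).
Hypothesis nuE : forall A, measurable A -> nu A = (\int[mu]_(x in A) (h x)%:E)%E.

Import HBNNSimple.

(** Indicators, then simple functions by linearity, then monotone limits. *)
Lemma ge0_integral_density (F : T -> \bar R) :
  measurable_fun [set: T] F -> (forall x, 0 <= F x)%E ->
  (\int[nu]_x F x = \int[mu]_x (F x * (h x)%:E))%E.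
Proof.
have meh : measurable_fun [set: T] (EFin \o h) by exact/measurable_EFinP.
have indic A : measurable A ->
    (\int[nu]_x (\1_A x)%:E = \int[mu]_x ((\1_A x)%:E * (h x)%:E))%E.
  move=> mA; rewrite integral_indic// setIT nuE// integral_mkcond.
  apply: eq_integral => x _; rewrite patchE indicE.
  by case: (x \in A); rewrite ?mul1e ?mul0e.
have simple (f : {nnsfun T >-> R}) :
    (\int[nu]_x (f x)%:E = \int[mu]_x ((f x)%:E * (h x)%:E))%E.
  under [LHS]eq_integral do rewrite fimfunE -fsumEFin//.
  rewrite [LHS]ge0_integral_fsum//; last 2 first.
  - by move=> r; exact/measurable_EFinP/measurableT_comp.
  - by move=> r x _; rewrite EFinM nnfun_muleindic_ge0.
  under [RHS]eq_integral => x _.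
    rewrite muleC fimfunE -fsumEFin// ge0_mule_fsumr; last first.
      by move=> r; rewrite EFinM nnfun_muleindic_ge0.
    over.
  rewrite [RHS]ge0_integral_fsum//; last 2 first.
  - move=> r; apply: emeasurable_funM => //.
    exact/measurable_EFinP/measurableT_comp.
  - by move=> r x _; rewrite EFinM mule_ge0 ?nnfun_muleindic_ge0// lee_fin.
  apply: eq_fsbigr => r _.
  have [r0|r0] := ltP r 0.
    rewrite !integral0_eq// => x _; rewrite preimage_nnfun0// indic0/=.
      by rewrite mulr0 mule0.
    by rewrite mulr0.
  under [LHS]eq_integral do rewrite EFinM.
  under [RHS]eq_integral do rewrite muleC EFinM -muleA.
  rewrite !ge0_integralZl ?lee_fin ?indic//.
  - by apply: emeasurable_funM => //; exact/measurable_EFinP.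
  - by move=> x _; rewrite mule_ge0 ?lee_fin.
  - exact/measurable_EFinP.
move=> mF F0; pose f_ := nnsfun_approx measurableT mF.
transitivity (limn (fun n => (\int[nu]_x (f_ n x)%:E)%E)).
  rewrite -monotone_convergence//=.
  - apply: eq_integral => x _; apply/esym/cvg_lim => //.
    exact: cvg_nnsfun_approx.
  - by move=> n; exact/measurable_EFinP/measurable_funTS.
  - by move=> n x _; rewrite lee_fin.
  - by move=> x _ m n mn; rewrite lee_fin; exact/lefP/nd_nnsfun_approx.
transitivity (limn (fun n => (\int[mu]_x ((f_ n x)%:E * (h x)%:E))%E)).
  by apply: congr_lim; apply/funext => n; exact: simple.
rewrite -monotone_convergence//=.
- apply: eq_integral => x _; apply/cvg_lim => //.
  rewrite muleC; under eq_fun do rewrite muleC.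
  by apply: cvgeZl => //; exact: cvg_nnsfun_approx.
- move=> n; apply: emeasurable_funM => //.
  exact/measurable_EFinP/measurable_funTS.
- by move=> n x _; rewrite mule_ge0 ?lee_fin.
- move=> x _ m n mn; apply: lee_wpmul2r; rewrite lee_fin//.
  exact/lefP/nd_nnsfun_approx.
Qed.

End density.

Section affine.
Variable R : realType.
Local Notation mu := (@lebesgue_measure R).

(** It is enough to compare, on half-open intervals, the Lebesgue measure with
    [`|s|] times its image under the affine map. *)
Lemma ge0_integral_affine (m s : R) (F : R -> \bar R) : s != 0 ->
  measurable_fun [set: R] F -> (forall x, 0 <= F x)%E ->
  (\int[mu]_x F x = `|s|%:E * \int[mu]_x F (m + s * x)%R)%E.
Proof.
move=> s0 mF F0.
have mphi : measurable_fun [set: measurableTypeR R]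
    (fun x => m + s * x : measurableTypeR R).
  by apply: measurable_funD => //; exact: measurable_funM.
pose phi := @mfun_Sub _ _ (measurableTypeR R) (measurableTypeR R) _
  (mem_set mphi).
pose k : {nonneg R} := NngNum (normr_ge0 s).
have E A : measurable A -> mu A = mscale k (pushforward mu phi) A.
  move=> mA; apply: lebesgue_measure_unique => // X [[a b] _ <-].
  pose f := fun x : R => m + s * x.
  transitivity (`|s|%:E * mu (f @^-1` `]a, b]))%E; last by [].
  have [sgt|slt|] := ltrgtP s 0; last by move=> sz; rewrite sz eqxx in s0.
  - have -> : f @^-1` `]a, b] = `[(b - m) / s, (a - m) / s[%classic.
      apply/seteqP; split => x /=; rewrite /f !in_itv/= !ler_ndivrMr// ltr_ndivlMr//.
        by move=> /andP[? ?]; apply/andP; split; lra.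
      by move=> /andP[? ?]; apply/andP; split; lra.
    rewrite !lebesgue_measure_itv/= !lte_fin ltr_ndivlMr// divfK ?lt_eqF//.
    rewrite ltrD2r; case: ifPn => // _; last by rewrite mule0.
    by rewrite -!EFinB -EFinM ltr0_norm//; congr EFin; field; rewrite lt_eqF.
  - have -> : f @^-1` `]a, b] = `](a - m) / s, (b - m) / s]%classic.
      apply/seteqP; split => x /=; rewrite /f !in_itv/= ltr_pdivrMr// ler_pdivlMr//.
        by move=> /andP[? ?]; apply/andP; split; lra.
      by move=> /andP[? ?]; apply/andP; split; lra.
    rewrite !lebesgue_measure_itv/= !lte_fin ltr_pM2r ?invr_gt0//.
    rewrite ltrD2r; case: ifPn => // _; last by rewrite mule0.
    by rewrite -!EFinB -EFinM gtr0_norm//; congr EFin; field; rewrite gt_eqF.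
rewrite (eq_measure_integral (mscale k (pushforward mu phi)))//; last first.
  by move=> A mA _; exact: E.
rewrite ge0_integral_mscale//=; congr (_ * _)%E.
by rewrite ge0_integral_pushforward.
Qed.

End affine.

(** * The standard normal law *)

Section standard_normal.
Variable R : realType.
Local Notation mu := (@lebesgue_measure R).
Local Notation gamma := (@normal_prob R 0 1).
Local Notation phi := (@normal_pdf R 0 1).

Let m_phi : measurable_fun [set: R] phi.
Proof. exact: measurable_normal_pdf. Qed.

Let phi_ge0 x : 0 <= phi x. Proof. exact: normal_pdf_ge0. Qed.

Let measurable_affine (m s : R) :
  measurable_fun [set: R] (fun z : R => m + s * z).
Proof. by apply: measurable_funD => //; exact: measurable_funM. Qed.

Lemma normal_pdf01E x : phi x = normal_peak 1 * expR (- (x ^+ 2 / 2)).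
Proof.
rewrite normal_pdfE ?oner_eq0// /normal_fun subr0 expr1n.
by rewrite mulNr.
Qed.

Lemma normal_pdf_affine m s z : s != 0 ->
  `|s| * normal_pdf m s (m + s * z) = phi z.
Proof.
move=> s0; rewrite normal_pdf01E normal_pdfE// /normal_fun mulrA.
congr (_ * expR _).
  rewrite /normal_peak expr1n mul1r -mulrnAr sqrtrM ?sqr_ge0// sqrtr_sqr invfM mulrA.
  by rewrite divff ?mul1r// normr_eq0.
by rewrite addrC addKr -mulr_natr; field.
Qed.

Lemma ge0_integral_normal01 (F : R -> \bar R) :
  measurable_fun [set: R] F -> (forall x, 0 <= F x)%E ->
  (\int[gamma]_x F x = \int[mu]_x (F x * (phi x)%:E))%E.
Proof. exact: (@ge0_integral_density _ (measurableTypeR R) _ mu _ phi). Qed.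

Lemma ge0_integral_normal m s (F : R -> \bar R) : s != 0 ->
  measurable_fun [set: R] F -> (forall x, 0 <= F x)%E ->
  (\int[normal_prob m s]_x F x = \int[gamma]_z F (m + s * z)%R)%E.
Proof.
move=> s0 mF F0.
have mFs : measurable_fun [set: R] (fun z => F (m + s * z)).
  by apply: measurableT_comp => //; exact: measurable_affine.
have mp : measurable_fun [set: R] (normal_pdf m s).
  exact: measurable_normal_pdf.
rewrite ge0_integral_normal01//.
transitivity (\int[mu]_x (F x * (normal_pdf m s x)%:E))%E.
  apply: (@ge0_integral_density _ (measurableTypeR R) _ mu _ _ mp) => //.
  by move=> x; exact: normal_pdf_ge0.
rewrite (ge0_integral_affine m s0)//; last 2 first.
- by apply: emeasurable_funM => //; exact/measurable_EFinP.
- by move=> x; rewrite mule_ge0// lee_fin normal_pdf_ge0.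
rewrite -ge0_integralZl//.
- apply: eq_integral => z _; rewrite muleCA -EFinM.
  by rewrite normal_pdf_affine.
- apply: emeasurable_funM => //; apply/measurable_EFinP.
  by apply: measurableT_comp => //; exact: measurable_affine.
- by move=> x _; rewrite mule_ge0// lee_fin normal_pdf_ge0.
Qed.

(** Completing the square. *)
Lemma ge0_integral_normal01_shift b (F : R -> \bar R) :
  measurable_fun [set: R] F -> (forall x, 0 <= F x)%E ->
  (\int[gamma]_z (F z * (expR (b * z - b ^+ 2 / 2))%:E) =
   \int[gamma]_z F (b + z)%R)%E.
Proof.
move=> mF F0.
have mE : measurable_fun [set: R] (fun z : R => expR (b * z - b ^+ 2 / 2)).
  by apply: measurableT_comp => //; exact: measurable_funB.
have mFb : measurable_fun [set: R] (fun z => F (b + z)).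
  by apply: measurableT_comp => //; exact: measurable_funD.
rewrite !ge0_integral_normal01//; last 2 first.
- by apply: emeasurable_funM => //; exact/measurable_EFinP.
- by move=> x; rewrite mule_ge0 ?lee_fin ?expR_ge0.
rewrite (@ge0_integral_affine _ b 1)// ?oner_eq0//; last 2 first.
- apply: emeasurable_funM; last exact/measurable_EFinP.
  by apply: emeasurable_funM => //; exact/measurable_EFinP.
- by move=> x; rewrite !mule_ge0 ?lee_fin ?expR_ge0.
rewrite normr1 mul1e; apply: eq_integral => z _.
rewrite mul1r -muleA -EFinM; congr (_ * _%:E)%E.
rewrite !normal_pdf01E mulrCA -expRD; congr (_ * expR _).
by field.
Qed.

Lemma integral_normal01_expR b :
  (\int[gamma]_z (expR (b * z))%:E = (expR (b ^+ 2 / 2))%:E)%E.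
Proof.
have E : (\int[gamma]_z (cst 1 z * (expR (b * z - b ^+ 2 / 2))%:E) = 1)%E.
  rewrite ge0_integral_normal01_shift// integral_cst//.
  by rewrite [X in (_ * X)%E](@probability_setT _ _ _ gamma) mule1.
have meb : measurable_fun [set: R] (fun z : R => (expR (b * z))%:E).
  by apply/measurable_EFinP; apply: measurableT_comp => //; exact: measurable_funM.
have {}E : (\int[gamma]_z (expR (b * z))%:E * (expR (b ^+ 2 / 2))^-1%:E = 1)%E.
  rewrite -E -ge0_integralZr//=.
  by apply: eq_integral => z _; rewrite mul1e expRD expRN EFinM.
by rewrite -[RHS]mul1e -E -muleA -EFinM mulVf ?mule1// gt_eqF ?expR_gt0.
Qed.

Lemma normal01_reflection (F : R -> \bar R) :
  measurable_fun [set: R] F -> (forall x, 0 <= F x)%E ->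
  (\int[gamma]_z F (- z)%R = \int[gamma]_z F z)%E.
Proof.
move=> mF F0.
have mFN : measurable_fun [set: R] (fun z => F (- z)) by exact: measurableT_comp.
rewrite !ge0_integral_normal01// [RHS](@ge0_integral_affine _ 0 (-1))//.
- rewrite normrN1 mul1e; apply: eq_integral => z _.
  by rewrite add0r mulN1r !normal_pdf01E sqrrN.
- by apply: emeasurable_funM => //; exact/measurable_EFinP.
- by move=> x; rewrite mule_ge0// lee_fin.
Qed.

Lemma normal01_norm a (F : R -> \bar R) :
  measurable_fun [set: R] F -> (forall x, 0 <= F x)%E ->
  (\int[gamma]_z F (a * z)%R = \int[gamma]_z F (`|a| * z)%R)%E.
Proof.
move=> mF F0; have [a0|a0] := lerP 0 a; first by rewrite ger0_norm.
rewrite ltr0_norm// -normal01_reflection//.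
- by apply: eq_integral => z _; rewrite mulrN mulNr.
- by apply: measurableT_comp => //; exact: measurable_funM.
Qed.

(** The product of the two densities is the product of a density in the sum
    and of one in the conditional value of the first summand. *)
Lemma normal01_convolution a b (F : R -> \bar R) :
  measurable_fun [set: R] F -> (forall x, 0 <= F x)%E ->
  (\int[gamma]_x \int[gamma]_y F (a * x + b * y)%R =
   \int[gamma]_z F (Num.sqrt (a ^+ 2 + b ^+ 2) * z)%R)%E.
Proof.
move=> mF F0.
have [->|b0] := eqVneq b 0.
  transitivity (\int[gamma]_x F (a * x)%R)%E.
    apply: eq_integral => x _.
    under eq_integral do rewrite mul0r addr0.
    rewrite integral_cst//.
    by rewrite [X in (_ * X)%E](@probability_setT _ _ _ gamma) mule1.
  by rewrite expr0n addr0 sqrtr_sqr normal01_norm.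
set r := Num.sqrt _.
have r0 : 0 < r.
  by rewrite sqrtr_gt0 ltr_wpDl ?sqr_ge0// exprn_even_gt0.
have rb0 : r / b != 0 by rewrite mulf_neq0 ?invr_neq0// gt_eqF.
have rE : r ^+ 2 = a ^+ 2 + b ^+ 2 by rewrite sqr_sqrtr// addr_ge0 ?sqr_ge0.
have mFab x : measurable_fun [set: R] (fun y => F (a * x + b * y)).
  by apply: measurableT_comp => //; exact: measurable_affine.
have mlin (c e : R) : measurable_fun [set: R * R] (fun z => c * z.1 + e * z.2).
  by apply: measurable_funD; apply: measurable_funM.
have mFlin : measurable_fun [set: R * R] (fun z => F (a * z.1 + b * z.2)).
  exact: measurableT_comp.
(* the integrand after the change of variable from y to
     u = (a x + b y) / r; the factor `|r / b| is its Jacobian *)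
pose G (z : R * R) := (F (r * z.2)%R * (phi (- (a / b) * z.1 + (r / b) * z.2) *
  (`|r / b| * phi z.1))%:E)%E.
have G0 z : (0 <= G z)%E.
  by rewrite mule_ge0// lee_fin mulr_ge0// mulr_ge0.
have mG : measurable_fun [set: R * R] G.
  apply: emeasurable_funM.
    by apply: measurableT_comp => //; exact: measurable_funM.
  apply/measurable_EFinP/measurable_funM; first exact: measurableT_comp.
  by apply: measurable_funM => //; exact: measurableT_comp.
transitivity (\int[mu]_x \int[mu]_u G (x, u))%E.
  rewrite ge0_integral_normal01//; last 2 first.
  - apply: (@measurable_fun_fubini_tonelli_F _ _ _ _ _ gamma
      (fun z : R * R => F (a * z.1 + b * z.2))) => //.
  - by move=> x; exact: integral_ge0.
  apply: eq_integral => x _.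
  rewrite ge0_integral_normal01//.
  rewrite (@ge0_integral_affine _ (- (a / b) * x) (r / b))//; last 2 first.
  - by apply: emeasurable_funM => //; exact/measurable_EFinP.
  - by move=> y; rewrite mule_ge0// lee_fin.
  rewrite muleAC -EFinM -ge0_integralZl//; last 3 first.
  - apply: emeasurable_funM.
      apply: measurableT_comp => //; apply: measurable_funD => //.
      by apply: measurable_funM => //; exact: measurable_affine.
    apply/measurable_EFinP; apply: measurableT_comp => //.
    exact: measurable_affine.
  - by move=> y _; rewrite mule_ge0// lee_fin.
  - by rewrite lee_fin mulr_ge0.
  apply: eq_integral => u _; rewrite /G/= muleCA -EFinM.
  congr (F _ * _%:E)%E; first by field.
  by rewrite mulrC.
rewrite (@fubini_tonelli _ _ _ _ _ mu mu G)//.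
rewrite ge0_integral_normal01//; last first.
  by apply: measurableT_comp => //; exact: measurable_funM.
apply: eq_integral => u _; rewrite /G/=.
under eq_integral => x _.
  rewrite (_ : phi _ * _ = phi u * (`|r / b| * phi (- (a / b) * u + (r / b) * x))).
    over.
  rewrite mulrCA [RHS]mulrCA; congr (_ * _).
  rewrite !normal_pdf01E mulrACA [RHS]mulrACA -!expRD; congr (_ * expR _).
  have -> : (- (a / b) * x + r / b * u) ^+ 2 =
      ((a ^+ 2 - r ^+ 2) / b ^+ 2) * x ^+ 2 +
      (r ^+ 2 * x ^+ 2 - 2 * a * r * x * u + r ^+ 2 * u ^+ 2) / b ^+ 2.
    by field.
  have -> : (- (a / b) * u + r / b * x) ^+ 2 =
      ((a ^+ 2 - r ^+ 2) / b ^+ 2) * u ^+ 2 +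
      (r ^+ 2 * x ^+ 2 - 2 * a * r * x * u + r ^+ 2 * u ^+ 2) / b ^+ 2.
    by field.
  by rewrite rE; field.
under eq_integral do rewrite EFinM muleA.
have mline : measurable_fun [set: R] (fun x : R => (phi (- (a / b) * u + r / b * x))%:E).
  by apply/measurable_EFinP; apply: measurableT_comp => //; exact: measurable_affine.
rewrite ge0_integralZl//; last 3 first.
- under eq_fun do rewrite EFinM.
  by apply: emeasurable_funM.
- by move=> x _; rewrite lee_fin mulr_ge0.
- by rewrite mule_ge0// lee_fin.
rewrite -[RHS]mule1; congr (_ * _)%E.
rewrite -(integral_normal_pdf 0 1).
rewrite [RHS](@ge0_integral_affine _ (- (a / b) * u) (r / b))//.
under eq_integral do rewrite EFinM.
rewrite ge0_integralZl//.
  by move=> x _; rewrite lee_fin.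
exact/measurable_EFinP.
Qed.

(** Up to the factor [u^-1], the integrand turns the standard density into that
    of the normal law of scale [u^-1]. *)
Lemma integral_normal01_expR_quad u : 0 < u ->
  (\int[gamma]_z (expR (- ((u ^+ 2 - 1) / 2 * z ^+ 2)))%:E = (u^-1)%:E)%E.
Proof.
move=> u0.
have mq : measurable_fun [set: R] (fun z : R => expR (- ((u ^+ 2 - 1) / 2 * z ^+ 2))).
  apply: measurableT_comp => //; apply: measurableT_comp => //.
  by apply: measurable_funM => //; exact: measurable_funX.
rewrite ge0_integral_normal01//; last exact/measurable_EFinP.
transitivity ((u^-1)%:E * \int[mu]_z (`|u|%:E * (phi (0 + u * z))%:E))%E.
  rewrite -ge0_integralZl//.
  - apply: eq_integral => z _; rewrite add0r gtr0_norm// -!EFinM mulrA mulVf ?gt_eqF//.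
    rewrite mul1r !normal_pdf01E mulrCA -expRD; congr (_ * expR _)%:E.
    by field.
  - apply/measurable_EFinP; apply: measurable_funM => //.
    by apply: measurableT_comp => //; exact: measurable_affine.
  - by move=> x _; rewrite mule_ge0 ?lee_fin.
  - by rewrite lee_fin invr_ge0 ltW.
rewrite ge0_integralZl//; last 2 first.
- apply/measurable_EFinP; apply: measurableT_comp => //; exact: measurable_affine.
- by move=> x _; rewrite lee_fin.
rewrite -(@ge0_integral_affine _ 0 u (EFin \o phi)) ?gt_eqF//.
- by rewrite integral_normal_pdf mule1.
- exact/measurable_EFinP.
Qed.

End standard_normal.

(** * Moments, and normal random variables *)

Section standard_normal_moments.
Variable R : realType.
Local Notation gamma := (@normal_prob R 0 1).

(** Integrating [1 + y <= expR y] against the rescaled densities bounds the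
    second moment from both sides, by bounds that meet as [u] tends to 1. *)
Lemma integral_normal01_sqr : (\int[gamma]_z (z ^+ 2)%:E = 1)%E.
Proof.
have msq : measurable_fun [set: R] (fun z : R => (z ^+ 2)%:E).
  exact/measurable_EFinP/measurable_funX.
have mcsq c : measurable_fun [set: R] (fun z : R => (c%:E * (z ^+ 2)%:E)%E).
  exact: emeasurable_funM.
have mq u : measurable_fun [set: R]
    (fun z : R => (expR (- ((u ^+ 2 - 1) / 2 * z ^+ 2)))%:E).
  apply/measurable_EFinP/measurableT_comp => //; apply: measurableT_comp => //.
  by apply: measurable_funM => //; exact: measurable_funX.
have sq0 c (z : R) : 0 <= c -> (0 <= c%:E * (z ^+ 2)%:E)%E.
  by move=> c0; rewrite mule_ge0 ?lee_fin ?sqr_ge0.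
have gamma1 : (\int[gamma]_z 1 = 1 :> \bar R)%E.
  by rewrite integral_cst// [X in (_ * X)%E](@probability_setT _ _ _ gamma) mule1.
set S := (\int[gamma]_z _)%E.
have S0 : (0 <= S)%E by apply: integral_ge0 => z _; rewrite lee_fin sqr_ge0.
have upper u : 0 < u < 1 -> (1 + ((1 - u ^+ 2) / 2)%:E * S <= u^-1%:E)%E.
  move=> /andP[u0 u1]; rewrite -integral_normal01_expR_quad//.
  have c0 : 0 <= (1 - u ^+ 2) / 2 by nra.
  rewrite -gamma1 -ge0_integralZl//; last by move=> z _; rewrite lee_fin sqr_ge0.
  rewrite -ge0_integralD//; [|by move=> z _; exact: sq0|exact: mcsq].
  apply: ge0_le_integral => //.
  - by move=> z _; rewrite adde_ge0// sq0.
  - by apply: emeasurable_funD => //; exact: mcsq.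
  - exact: mq.
  - move=> z _; rewrite -EFinM -EFinD lee_fin.
    have -> : (1 - u ^+ 2) / 2 * z ^+ 2 = - ((u ^+ 2 - 1) / 2 * z ^+ 2) by ring.
    exact: expR_ge1Dx.
have lower u : 1 < u -> (1 <= u^-1%:E + ((u ^+ 2 - 1) / 2)%:E * S)%E.
  move=> u1; have u0 : 0 < u by exact: lt_trans u1.
  rewrite -integral_normal01_expR_quad//.
  have c0 : 0 <= (u ^+ 2 - 1) / 2 by nra.
  rewrite -[leLHS]gamma1 -ge0_integralZl//; last first.
    by move=> z _; rewrite lee_fin sqr_ge0.
  rewrite -ge0_integralD//; [|exact: mq|by move=> z _; exact: sq0|exact: mcsq].
  apply: ge0_le_integral => //; first by apply: emeasurable_funD; [exact: mq|exact: mcsq].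
  move=> z _; rewrite -EFinM -EFinD lee_fin -lerBlDr.
  exact: expR_ge1Dx.
have : S \is a fin_num.
  have /upper : 0 < (2^-1 : R) < 1 by apply/andP; split; lra.
  have -> : (1 - 2^-1 ^+ 2) / 2 = 3 / 8 :> R by field.
  rewrite ge0_fin_numE//.
  case: S S0 {upper lower} => [r _ _|_|//]; first exact: ltry.
  by rewrite gt0_muley ?lte_fin ?addey//; lra.
case: S S0 upper lower => // s; rewrite lee_fin => s0 upper lower _.
have {}upper u : 0 < u < 1 -> u * (1 + u) * s <= 2.
  move=> /[dup] /andP[u0 u1] /upper.
  rewrite -EFinM -EFinD lee_fin -(ler_pM2l u0) divff ?gt_eqF// => H.
  have : (1 - u) * (u * (1 + u) * s) <= (1 - u) * 2 by nra.
  by rewrite ler_pM2l// subr_gt0.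
have {}lower u : 1 < u -> 2 <= u * (1 + u) * s.
  move=> /[dup] u1 /lower; have u0 : 0 < u by exact: lt_trans u1.
  rewrite -EFinM -EFinD lee_fin -(ler_pM2l u0) mulrDr divff ?gt_eqF// => H.
  have : (u - 1) * 2 <= (u - 1) * (u * (1 + u) * s) by nra.
  by rewrite ler_pM2l// subr_gt0.
clear gamma1; congr EFin; have {}s0 : 0 < s.
  rewrite lt_neqAle s0 andbT; apply/eqP => s00.
  by have := lower 2; rewrite -s00 mulr0 ltr1n => /(_ isT); lra.
have [s1|s1|//] := ltrgtP s 1.
- have u1 : 1 < 2 / (1 + s) by rewrite ltr_pdivlMr; nra.
  have := lower _ u1.
  suff : 2 / (1 + s) * (1 + 2 / (1 + s)) * s < 2 by move=> /lt_le_trans/[apply]; rewrite ltxx.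
  have -> : 2 / (1 + s) * (1 + 2 / (1 + s)) * s = 2 * (s * (3 + s)) / (1 + s) ^+ 2.
    by field; lra.
  by rewrite ltr_pdivrMr; nra.
- have u1 : 0 < (1 + s) / (2 * s) < 1.
    by rewrite divr_gt0 ?ltr_pdivrMr /=; nra.
  have := upper _ u1.
  suff : 2 < (1 + s) / (2 * s) * (1 + (1 + s) / (2 * s)) * s.
    by move=> /lt_le_trans/[apply]; rewrite ltxx.
  have -> : (1 + s) / (2 * s) * (1 + (1 + s) / (2 * s)) * s =
    (1 + s) * (1 + 3 * s) / (4 * s) by field; lra.
  by rewrite ltr_pdivlMr; nra.
Qed.

Lemma integrable_normal01_sqr : gamma.-integrable [set: R] (fun z => (z ^+ 2)%:E).
Proof.
apply/integrableP; split; first exact/measurable_EFinP/measurable_funX.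
under eq_integral do rewrite gee0_abs ?lee_fin ?sqr_ge0//.
by rewrite integral_normal01_sqr ltry.
Qed.

Lemma integrable_normal01_id : gamma.-integrable [set: R] EFin.
Proof.
have m1 : measurable_fun [set: R] (@EFin R) by exact/measurable_EFinP.
apply: (@le_integrable _ _ _ gamma _ _ _ (fun z => 1%:E + (z ^+ 2)%:E)%E) => //.
  move=> z _; rewrite -EFinD !abse_EFin lee_fin [leRHS]ger0_norm.
    have := sqr_ge0 (`|z| - 1); rewrite sqrrB1 real_normK ?num_real//.
    by have := sqr_ge0 z; nra.
  by rewrite addr_ge0 ?sqr_ge0.
apply: integrableD => //; last exact: integrable_normal01_sqr.
exact: finite_measure_integrable_cst.
Qed.

Lemma integral_normal01_id : (\int[gamma]_z z%:E = 0)%E.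
Proof.
have m1 : measurable_fun [set: R] (@EFin R) by exact/measurable_EFinP.
rewrite integralE.
transitivity (\int[gamma]_z (EFin^\+ z) - \int[gamma]_z (EFin^\+ z))%E.
  congr (_ - _)%E; rewrite -[RHS]normal01_reflection//; last exact: measurable_funepos.
  by apply: eq_integral => z _; rewrite funenegE funeposE EFinN.
rewrite subee//; apply: integrable_fin_num => //.
by apply: integrable_funepos => //; exact: integrable_normal01_id.
Qed.
End standard_normal_moments.

Section Lnorm2.
Context d (T : measurableType d) (R : realType) (mu : {measure set T -> \bar R}).

Lemma Lnorm2E (f : T -> R) :
  ('N[mu]_2%:E[EFin \o f] = (\int[mu]_x (f x ^+ 2)%:E) `^ 2^-1)%E.
Proof.
rewrite unlock /Lnorm; congr (_ `^ _)%E; apply: eq_integral => x _ /=.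
by rewrite powR_mulrn// real_normK ?num_real.
Qed.

Lemma Lfun2_sqr (f : T -> R) : measurable_fun [set: T] f ->
  (\int[mu]_x (f x ^+ 2)%:E < +oo)%E -> f \in Lfun mu 2%:E.
Proof.
move=> mf foo; rewrite inE; apply/andP; split; rewrite inE//=.
by rewrite /finite_norm Lnorm2E poweR_lty.
Qed.
End Lnorm2.

Section normal_law.
Context d (Omega : measurableType d) (R : realType) (P : probability Omega R).
Local Notation gamma := (@normal_prob R 0 1).

(** Written with a standard normal variable rather than with the density of
    scale [s], so that [s = 0] is not an exception: the noise in the direction
    of the zero function is degenerate. *)
Definition normal_law (X : Omega -> R) (m s : R) :=
  forall F : R -> \bar R, measurable_fun [set: R] F -> (forall x, 0 <= F x)%E ->
    (\int[P]_w F (X w) = \int[gamma]_z F (m + s * z)%R)%E.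

Variables (X : Omega -> R) (mX : measurable_fun [set: Omega] X).

Lemma gaussian_normal_law : gaussian P X ->
  exists m v, 0 <= v /\ normal_law X m (Num.sqrt v).
Proof.
move=> [m [v [v0 H]]]; exists m, v; split => // F mF F0.
pose X' := @mfun_Sub _ _ Omega (measurableTypeR R) _ (mem_set mX).
transitivity (\int[pushforward P X']_x F x)%E.
  by rewrite ge0_integral_pushforward.
have [v00|v00] := eqVneq v 0.
  transitivity (\int[\d_(m : measurableTypeR R)]_x F x)%E.
    apply: eq_measure_integral => A mA _.
    by rewrite /pushforward [LHS](H _ mA) v00 eqxx.
  rewrite integral_dirac// diracT mul1e v00 sqrtr0.
  under eq_integral do rewrite mul0r addr0.
  rewrite integral_cst//.
  by rewrite [X in (_ * X)%E](@probability_setT _ _ _ gamma) mule1.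
rewrite -ge0_integral_normal//; last by rewrite sqrtr_eq0 -ltNge lt_neqAle eq_sym v00.
apply: eq_measure_integral => A mA _.
by rewrite /pushforward [LHS](H _ mA) (negbTE v00).
Qed.

Variables (m s : R).
Hypothesis HX : normal_law X m s.

Lemma normal_law_integral (F : R -> \bar R) : measurable_fun [set: R] F ->
  (\int[P]_w F (X w) = \int[gamma]_z F (m + s * z)%R)%E.
Proof.
move=> mF; rewrite integralE [RHS]integralE; congr (_ - _)%E.
- transitivity (\int[P]_w F^\+ (X w))%E.
    by apply: eq_integral => w _; rewrite !funeposE.
  rewrite HX//; last exact: measurable_funepos.
  by apply: eq_integral => z _; rewrite !funeposE.
- transitivity (\int[P]_w F^\- (X w))%E.
    by apply: eq_integral => w _; rewrite !funenegE.
  rewrite HX//; last exact: measurable_funeneg.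
  by apply: eq_integral => z _; rewrite !funenegE.
Qed.

Lemma normal_law_sqr : (\int[P]_w (X w ^+ 2)%:E = (m ^+ 2 + s ^+ 2)%:E)%E.
Proof.
rewrite (HX (F := fun x => (x ^+ 2)%:E)); last 2 first.
- exact/measurable_EFinP/measurable_funX.
- by move=> x; rewrite lee_fin sqr_ge0.
have i1 := integrable_normal01_id R; have i2 := integrable_normal01_sqr R.
have [c cE] : exists c, c = 2 * m * s by exists (2 * m * s).
under eq_integral => z _.
  rewrite (_ : (m + s * z) ^+ 2 = m ^+ 2 + (c * z + s ^+ 2 * z ^+ 2)); last by rewrite cE; ring.
  rewrite EFinD; over.
rewrite /= integralD//; last 2 first.
- exact: finite_measure_integrable_cst.
- under eq_fun do rewrite EFinD (EFinM c) (EFinM (s ^+ 2)).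
  by apply: integrableD => //; exact: integrableZl.
rewrite integral_cst//.
rewrite [X in (_ * X + _)%E](@probability_setT _ _ _ gamma) mule1.
under eq_integral do rewrite EFinD (EFinM c) (EFinM (s ^+ 2)).
rewrite integralD//; [|exact: integrableZl..].
rewrite !integralZl//.
by rewrite integral_normal01_sqr integral_normal01_id mule0 mule1 add0e.
Qed.

Lemma normal_law_mean : (\int[P]_w (X w)%:E = m%:E)%E.
Proof.
rewrite (normal_law_integral (F := EFin)); last exact/measurable_EFinP.
have i1 := integrable_normal01_id R.
under eq_integral do rewrite EFinD EFinM.
rewrite integralD//; last 2 first.
- exact: finite_measure_integrable_cst.
- exact: integrableZl.
rewrite integralZl// integral_normal01_id mule0 adde0 integral_cst//.
by rewrite [X in (_ * X)%E](@probability_setT _ _ _ gamma) mule1.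
Qed.

Lemma normal_law_Lfun2 : X \in Lfun P 2%:E.
Proof.
by apply: Lfun2_sqr => //; rewrite normal_law_sqr ltry.
Qed.

Lemma normal_law_expR : m = 0 -> (\int[P]_w (expR (X w))%:E = (expR (s ^+ 2 / 2))%:E)%E.
Proof.
move=> m0; rewrite (HX (F := fun x => (expR x)%:E)).
- by rewrite m0; under eq_integral do rewrite add0r; exact: integral_normal01_expR.
- exact/measurable_EFinP.
- by move=> x; rewrite lee_fin expR_ge0.
Qed.
End normal_law.

(** * Trigonometric moments determine finite-dimensional laws *)

Section real_sequences.
Variable R : realType.
Implicit Types x u q : R.

Lemma exprD1_ge x n : 0 <= x -> 1 + n%:R * x <= (1 + x) ^+ n.
Proof.
move=> x0; elim: n => [|n IH]; first by rewrite mul0r addr0.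
rewrite exprS -natr1; apply: (@le_trans _ _ ((1 + x) * (1 + n%:R * x))).
  by have := ler0n R n; nra.
by rewrite ler_wpM2l// addr_ge0.
Qed.

Lemma exprB1_ge x n : 0 <= x <= 1 -> 1 - n%:R * x <= (1 - x) ^+ n.
Proof.
move=> /andP[x0 x1]; elim: n => [|n IH]; first by rewrite mul0r subr0.
rewrite exprS -natr1; apply: (@le_trans _ _ ((1 - x) * (1 - n%:R * x))).
  by have := ler0n R n; nra.
by rewrite ler_wpM2l// subr_ge0.
Qed.

Lemma exprB1_le x n : 0 <= x <= 1 -> (1 - x) ^+ n <= (1 + n%:R * x)^-1.
Proof.
move=> /andP[x0 x1].
have pos : 0 < 1 + n%:R * x by rewrite ltr_wpDr// mulr_ge0.
rewrite -[leRHS]mul1r ler_pdivlMr//.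
apply: (@le_trans _ _ ((1 - x) ^+ n * (1 + x) ^+ n)).
  by rewrite ler_wpM2l ?exprD1_ge// exprn_ge0// subr_ge0.
rewrite -exprMn exprn_ile1//; first by apply: mulr_ge0; lra.
by have := sqr_ge0 x; nra.
Qed.

Lemma cvg_natM_geometric q : 0 <= q < 1 ->
  n%:R * q ^+ n @[n --> \oo] --> (0 : R).
Proof.
move=> /andP[q0 q1].
have [->|qn0] := eqVneq q 0.
  apply: cvg_near_cst; exists 1%N => // n /= n0.
  by rewrite expr0n; case: n n0 => //= n _; rewrite mulr0.
have {qn0}q0 : 0 < q by rewrite lt_neqAle eq_sym qn0.
set r := Num.sqrt q.
have r0 : 0 < r by rewrite sqrtr_gt0.
have r1 : r < 1 by rewrite -sqrtr1 ltr_sqrt.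
pose h := r^-1 - 1.
have h0 : 0 < h by rewrite subr_gt0 invf_gt1.
apply: (@squeeze_cvgr _ _ _ _ (cst 0) (geometric h^-1 r)).
- apply: nearW => n; rewrite /= mulr_ge0 ?exprn_ge0 ?(ltW q0)//=.
  have := exprD1_ge n (ltW h0); rewrite /h addrCA subrr addr0 exprVn.
  rewrite -/h -(ler_pM2r (exprn_gt0 n r0)) mulVf ?expf_neq0 ?gt_eqF// => H.
  have -> : q ^+ n = r ^+ n * r ^+ n by rewrite -exprMn -expr2 sqr_sqrtr// ltW.
  rewrite mulrA ler_wpM2r ?exprn_ge0 ?(ltW r0)// -[leRHS]mul1r ler_pdivlMr//.
  by apply: le_trans H; have := exprn_gt0 n r0; nra.
- exact: cvg_cst.
- by apply: cvg_geometric; rewrite gtr0_norm.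
Qed.

(** These polynomials in [u] approximate a threshold at [1 / 2], boundedly and
    at every point of the unit interval, threshold included. *)
Lemma cvg_threshold u : 0 <= u <= 1 ->
  (1 - u ^+ n) ^+ (n * 2 ^ n) @[n --> \oo] --> ((u < 2^-1)%R%:R : R).
Proof.
move=> /andP[u0 u1].
have un n : 0 <= u ^+ n <= 1 by rewrite exprn_ge0 ?exprn_ile1.
have Nu n : (n * 2 ^ n)%:R * u ^+ n = n%:R * (2 * u) ^+ n.
  by rewrite natrM natrX -mulrA exprMn.
have [u2|u2] := ltP u 2^-1.
- apply: (@squeeze_cvgr _ _ _ _ (fun n => 1 - n%:R * (2 * u) ^+ n) (cst 1)).
  + apply: nearW => n; apply/andP; split.
      by have := exprB1_ge (n * 2 ^ n) (un n); rewrite Nu.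
    by have /andP[? ?] := un n; rewrite exprn_ile1// ?subr_ge0// lerBlDr lerDl.
  + rewrite -[X in _ --> X](subr0 1); apply: cvgB; first exact: cvg_cst.
    by apply: cvg_natM_geometric; apply/andP; split; lra.
  + exact: cvg_cst.
- apply: (@squeeze_cvgr _ _ _ _ (cst 0) (fun n => n.+1%:R^-1)).
  + apply: nearW => n; apply/andP; split.
      by have /andP[? ?] := un n; rewrite exprn_ge0// subr_ge0.
    apply: le_trans (exprB1_le _ (un n)) _.
    rewrite lef_pV2 ?posrE ?ltr_wpDr// ?mulr_ge0 ?exprn_ge0// Nu -natr1 addrC lerD2l.
    by rewrite ler_peMr// exprn_ege1//; lra.
  + exact: cvg_cst.
  + exact: cvg_harmonic.
Qed.
End real_sequences.

Section cramer_wold.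
Context (R : realType) (I : Type).

Definition lincomb (t : seq (R * I)) (x : I -> R) := \sum_(u <- t) u.1 * x u.2.

Lemma lincomb_cat t1 t2 x : lincomb (t1 ++ t2) x = lincomb t1 x + lincomb t2 x.
Proof. by rewrite /lincomb big_cat. Qed.

Lemma lincomb_opp t x : lincomb [seq (- u.1, u.2) | u <- t] x = - lincomb t x.
Proof.
by rewrite /lincomb big_map -sumrN; apply: eq_bigr => u _; rewrite mulNr.
Qed.

Lemma lincomb_cons a i t x : lincomb ((a, i) :: t) x = a * x i + lincomb t x.
Proof. by rewrite /lincomb big_cons. Qed.

Lemma lincomb1 a i x : lincomb [:: (a, i)] x = a * x i.
Proof. by rewrite /lincomb big_seq1. Qed.

Lemma measurable_lincomb d (T : measurableType d) (X : T -> I -> R) t :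
  (forall i, measurable_fun [set: T] (X ^~ i)) ->
  measurable_fun [set: T] (fun w => lincomb t (X w)).
Proof.
move=> mX; apply: measurable_sum => u; exact: measurable_funM.
Qed.

Section bounded_convergence.
Context d (T : measurableType d) (P : probability T R).

Lemma integrable_bounded (f : T -> R) (M : R) : measurable_fun [set: T] f ->
  (forall w, `|f w| <= M) -> P.-integrable [set: T] (EFin \o f).
Proof.
move=> mf fM; apply: measurable_bounded_integrable => //.
  by rewrite [ltLHS](@probability_setT _ _ _ P) ltry.
by exists M; split; [exact: num_real|move=> N MN w _; exact: le_trans (fM w) (ltW MN)].
Qed.

Lemma bounded_cvg_Rintegral (f_ : nat -> T -> R) (f : T -> R) (M : R) :
  (forall n, measurable_fun [set: T] (f_ n)) ->
  (forall n w, `|f_ n w| <= M) ->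
  (forall w, f_ n w @[n --> \oo] --> f w) ->
  \int[P]_w f_ n w @[n --> \oo] --> \int[P]_w f w.
Proof.
move=> mf fM ff.
have mlim : measurable_fun [set: T] f.
  by apply: (measurable_fun_cvg mf) => w _; exact: ff.
have fMlim w : `|f w| <= M.
  have /cvg_norm ffw := ff w.
  apply: (cvgr_to_le ffw); apply: nearW => n; exact: fM.
apply: fine_cvg; rewrite fineK; last first.
  by apply: integrable_fin_num => //; exact: integrable_bounded fMlim.
apply: (dominated_cvg measurableT (g := cst M%:E)) => //.
- by move=> n; exact/measurable_EFinP.
- by move=> w _; apply: cvg_EFin; [exact: nearW|exact: ff].
- exact: finite_measure_integrable_cst.
- by move=> n w _; rewrite lee_fin.
Qed.
End bounded_convergence.

Context d1 d2 (T1 : measurableType d1) (T2 : measurableType d2).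
Variables (P1 : probability T1 R) (P2 : probability T2 R).
Variables (X1 : T1 -> I -> R) (X2 : T2 -> I -> R).
Hypothesis mX1 : forall i, measurable_fun [set: T1] (X1 ^~ i).
Hypothesis mX2 : forall i, measurable_fun [set: T2] (X2 ^~ i).
Hypothesis cosE : forall t b, \int[P1]_w cos (lincomb t (X1 w) + b) =
                              \int[P2]_w cos (lincomb t (X2 w) + b).

Let wave t b (x : I -> R) := cos (lincomb t x + b).

Let m_wave d (T : measurableType d) (X : T -> I -> R) t b :
  (forall i, measurable_fun [set: T] (X ^~ i)) ->
  measurable_fun [set: T] (fun w => wave t b (X w)).
Proof.
move=> mX; apply: (measurableT_comp (continuous_measurable_fun (@continuous_cos R))).
by apply: measurable_funD => //; exact: measurable_lincomb.
Qed.

Let wave_le1 t b x : `|wave t b x| <= 1.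
Proof. by rewrite ler_norml cos_geN1 cos_le1. Qed.

(** The functionals that cannot tell [X1] from [X2]. Allowing an extra wave as
    a factor, and not only comparing the means of [F], is what makes the class
    stable under multiplication by waves. *)
Record indistinct (F : (I -> R) -> R) : Prop := {
  indistinct_m1 : measurable_fun [set: T1] (F \o X1);
  indistinct_m2 : measurable_fun [set: T2] (F \o X2);
  indistinct_bounded : exists M, forall x, `|F x| <= M;
  indistinctE : forall t b,
    \int[P1]_w (F (X1 w) * wave t b (X1 w)) =
    \int[P2]_w (F (X2 w) * wave t b (X2 w)) }.

Let integrableZ d (T : measurableType d) (P : probability T R) (f : T -> R) a :
  P.-integrable [set: T] (EFin \o f) ->
  P.-integrable [set: T] (EFin \o (fun w => a * f w)).
Proof.
move=> fi; rewrite (_ : _ \o _ = (fun w => a%:E * (f w)%:E)%E); first exact: integrableZl.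
by apply/funext => w /=; rewrite EFinM.
Qed.

Let integrable_wave d (T : measurableType d) (P : probability T R)
    (X : T -> I -> R) (F : (I -> R) -> R) (M : R) t b :
  (forall i, measurable_fun [set: T] (X ^~ i)) ->
  measurable_fun [set: T] (F \o X) -> (forall x, `|F x| <= M) ->
  P.-integrable [set: T] (EFin \o (fun w => F (X w) * wave t b (X w))).
Proof.
move=> mX mF FM; apply: (@integrable_bounded _ _ P _ M).
  by apply: measurable_funM => //; exact: m_wave.
by move=> w; rewrite normrM (le_trans _ (FM (X w)))// ler_piMr.
Qed.

Lemma indistinct1 : indistinct (cst 1).
Proof.
split; [exact: measurable_cst|exact: measurable_cst| |].
  by exists 1 => x; rewrite normr1.
by move=> t b; under eq_Rintegral do rewrite mul1r;
   under [RHS]eq_Rintegral do rewrite mul1r; exact: cosE.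
Qed.

Lemma indistinctD a F G : indistinct F -> indistinct G ->
  indistinct (fun x => F x + a * G x).
Proof.
move=> [mF1 mF2 [MF FM] FE] [mG1 mG2 [MG GM] GE]; split.
- by apply: measurable_funD => //; exact: measurable_funM.
- by apply: measurable_funD => //; exact: measurable_funM.
- exists (MF + `|a| * MG) => x; rewrite (le_trans (ler_normD _ _))// lerD// normrM.
  by rewrite ler_wpM2l.
move=> t b.
under eq_Rintegral do rewrite mulrDl -mulrA.
under [RHS]eq_Rintegral do rewrite mulrDl -mulrA.
have i1 := integrable_wave P1 t b mX1 mF1 FM.
have i2 := integrable_wave P2 t b mX2 mF2 FM.
have j1 := integrable_wave P1 t b mX1 mG1 GM.
have j2 := integrable_wave P2 t b mX2 mG2 GM.
rewrite !RintegralD//; last 2 first.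
- exact: integrableZ.
- exact: integrableZ.
by rewrite !RintegralZl// FE GE.
Qed.

Lemma eq_indistinct F G : F =1 G -> indistinct F -> indistinct G.
Proof. by move=> /funext ->. Qed.

Lemma indistinctZ a F : indistinct F -> indistinct (fun x => a * F x).
Proof.
move=> iF; apply: eq_indistinct (indistinctD (a - 1) iF iF) => x; ring.
Qed.

(** Trigonometric polynomials are closed under product. *)
Lemma indistinct_wave s c F : indistinct F -> indistinct (fun x => F x * wave s c x).
Proof.
move=> [mF1 mF2 [M FM] FE]; split.
- by apply: measurable_funM => //; exact: m_wave.
- by apply: measurable_funM => //; exact: m_wave.
- by exists M => x; rewrite normrM (le_trans _ (FM x))// ler_piMr.
move=> t b.
have E x : F x * wave s c x * wave t b x = 2^-1 *
    (F x * wave (s ++ t) (c + b) x) + 2^-1 *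
     (F x * wave (s ++ [seq (- u.1, u.2) | u <- t]) (c - b) x).
  rewrite /wave !lincomb_cat lincomb_opp.
  rewrite (_ : _ + _ + (c + b) = (lincomb s x + c) + (lincomb t x + b)); last by ring.
  rewrite (_ : _ - _ + (c - b) = (lincomb s x + c) - (lincomb t x + b)); last by ring.
  move: (_ + c) (_ + b) => A B.
  by rewrite cosD cosB; field.
under eq_Rintegral do rewrite E.
under [RHS]eq_Rintegral do rewrite E.
have i1 t' b' := integrable_wave P1 t' b' mX1 mF1 FM.
have i2 t' b' := integrable_wave P2 t' b' mX2 mF2 FM.
rewrite !RintegralD//; [|exact: integrableZ..].
by rewrite !RintegralZl// !FE.
Qed.

Lemma indistinct_cvg (F_ : nat -> (I -> R) -> R) F M :
  (forall n, indistinct (F_ n)) -> (forall n x, `|F_ n x| <= M) ->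
  (forall x, F_ n x @[n --> \oo] --> F x) -> indistinct F.
Proof.
move=> iF FM FF.
have mF1 : measurable_fun [set: T1] (F \o X1).
  apply: (measurable_fun_cvg (h := fun n => F_ n \o X1)) => [n|w _].
    exact: indistinct_m1.
  exact: FF.
have mF2 : measurable_fun [set: T2] (F \o X2).
  apply: (measurable_fun_cvg (h := fun n => F_ n \o X2)) => [n|w _].
    exact: indistinct_m2.
  exact: FF.
split=> //.
  exists M => x; have /cvg_norm ffx := FF x.
  by apply: (cvgr_to_le ffx); apply: nearW => n; exact: FM.
move=> t b.
have lim d (T : measurableType d) (P : probability T R) (X : T -> I -> R) :
    (forall i, measurable_fun [set: T] (X ^~ i)) ->
    (forall n, measurable_fun [set: T] (F_ n \o X)) ->
    \int[P]_w (F_ n (X w) * wave t b (X w)) @[n --> \oo] -->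
    \int[P]_w (F (X w) * wave t b (X w)).
  move=> mX mFX; apply: (@bounded_cvg_Rintegral _ _ _ _ _ M).
  - by move=> n; apply: measurable_funM; [exact: mFX|exact: m_wave].
  - by move=> n w; rewrite normrM (le_trans _ (FM n (X w)))// ler_piMr.
  - by move=> w; apply: cvgM; [exact: FF|exact: cvg_cst].
have l1 := lim _ _ P1 X1 mX1 (fun n => indistinct_m1 (iF n)).
have l2 := lim _ _ P2 X2 mX2 (fun n => indistinct_m2 (iF n)).
move: l1; under eq_fun do rewrite (indistinctE (iF _)).
by move=> l1; exact: cvg_unique l1 l2.
Qed.

(** The positivity of a wave is a threshold for [(1 - wave) / 2], hence a
    bounded limit of polynomials in the wave. *)
Lemma indistinct_wave_gt0 s c F : indistinct F ->
  indistinct (fun x => F x * (0 < wave s c x)%R%:R).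
Proof.
move=> iF; pose u x : R := (1 - wave s c x) / 2.
have u01 x : 0 <= u x <= 1.
  have := wave_le1 s c x; rewrite ler_norml /u; move: (wave s c x) => y.
  by move=> /andP[? ?]; apply/andP; split; lra.
have step G : indistinct G -> indistinct (fun x => G x * u x).
  move=> iG; apply: eq_indistinct (indistinctZ 2^-1
    (indistinctD (-1) iG (indistinct_wave s c iG))) => x.
  by rewrite /u; move: (wave s c x) => y; field.
have iXn n G : indistinct G -> indistinct (fun x => G x * u x ^+ n).
  move=> iG; elim: n => [|n IH].
    by apply: eq_indistinct iG => x; rewrite mulr1.
  by apply: eq_indistinct (step _ IH) => x /=; rewrite exprSr mulrA.
have iBn n k G : indistinct G -> indistinct (fun x => G x * (1 - u x ^+ n) ^+ k).
  move=> iG; elim: k => [|k IH].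
    by apply: eq_indistinct iG => x; rewrite mulr1.
  apply: eq_indistinct (indistinctD (-1) IH (iXn n _ IH)) => x.
  by rewrite /= exprSr; ring.
have [M FM] := indistinct_bounded iF.
apply: (@indistinct_cvg
  (fun n x => F x * (1 - u x ^+ n) ^+ (n * 2 ^ n)) _ M) => [n|n x|x].
- exact: iBn.
- have /andP[u0 u1] := u01 x; rewrite normrM (le_trans _ (FM x))// ler_piMr//.
  have B1 : 0 <= 1 - u x ^+ n by rewrite subr_ge0 exprn_ile1.
  by rewrite ger0_norm ?exprn_ge0// exprn_ile1// gerBl exprn_ge0.
- have -> : (0 < wave s c x) = (u x < 2^-1).
    by rewrite /u; move: (wave s c x) => y; apply/idP/idP => ?; lra.
  by apply: cvgM; [exact: cvg_cst|exact: cvg_threshold].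
Qed.

(** On each bounded range, a wave of long enough period is positive exactly on
    one side of its zero. *)
Lemma indistinct_ray i a F : indistinct F -> indistinct (fun x => F x * (a < x i)%R%:R).
Proof.
move=> iF; have [M FM] := indistinct_bounded iF.
pose s n : R := n.+1%:R^-1.
apply: (@indistinct_cvg (fun n x =>
  F x * (0 < wave [:: (s n, i)] (- (s n * a) - pi / 2) x)%R%:R) _ M) => [n|n x|x].
- exact: indistinct_wave_gt0.
- by rewrite normrM (le_trans _ (FM x))// ler_piMr//; case: ltP; rewrite ?normr1 ?normr0.
have s0 n : 0 < s n by rewrite invr_gt0.
have waveE n : wave [:: (s n, i)] (- (s n * a) - pi / 2) x = sin (s n * (x i - a)).
  by rewrite /wave lincomb1 addrA cosBpihalf mulrBr.
apply: cvgM; first exact: cvg_cst.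
(* the sine has the sign of its argument on ]-2, 2[ *)
have small : \forall n \near \oo, `|s n * (x i - a)| < 2.
  near=> n; rewrite normrM gtr0_norm// mulrC ltr_pdivrMr//.
  rewrite -ltr_pdivrMl// (@lt_le_trans _ _ n%:R)//; last by rewrite ler_nat.
  by near: n; exact: nbhs_infty_gtr.
apply: cvg_near_cst; near=> n; rewrite waveE; congr (_%:R).
have : `|s n * (x i - a)| < 2 by near: n; exact: small.
rewrite ltr_norml => /andP[l u].
have [ax|ax|ax] := ltrgtP a (x i).
- by congr nat_of_bool; rewrite sin2_gt0// u mulr_gt0// subr_gt0.
- congr nat_of_bool; apply/negbTE; rewrite -leNgt -oppr_ge0 -sinN ltW// sin2_gt0//.
  by rewrite -mulrN opprB mulr_gt0 ?subr_gt0//=; move: l; nra.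
- by rewrite ax subrr mulr0 sin0 ltxx.
Unshelve. all: by end_near. Qed.

(** The Cramer-Wold principle: every indicator of a product of half-lines is
    reached from the constant [1] by [indistinct_ray]. *)
Lemma rays_indistinct (r : seq (I * R)) :
  P1 [set w | all (fun u => u.2 < X1 w u.1) r] =
  P2 [set w | all (fun u => u.2 < X2 w u.1) r].
Proof.
have mall d (T : measurableType d) (X : T -> I -> R) q :
    (forall i, measurable_fun [set: T] (X ^~ i)) ->
    measurable [set w | all (fun u => u.2 < X w u.1) q].
  move=> mX; elim: q => [|[i a] q IH] /=.
    by rewrite (_ : [set _ | _] = setT)//; apply/seteqP; split.
  rewrite (_ : [set _ | _] = (X ^~ i @^-1` `]a, +oo[) `&`
      [set w | all (fun u => u.2 < X w u.1) q]); last first.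
    by apply/seteqP; split=> w /=; rewrite in_itv/= andbT => /andP.
  by apply: measurableI => //; rewrite -[X in measurable X]setTI; exact: mX.
have iG : indistinct (fun x => (all (fun u => u.2 < x u.1) r)%:R).
  elim: r => [|[i a] r IH]; first exact: eq_indistinct indistinct1.
  apply: eq_indistinct (indistinct_ray i a IH) => x /=.
  by case: (a < x i); rewrite /= ?mulr1 ?mulr0.
have E d (T : measurableType d) (P : probability T R) (X : T -> I -> R) :
    (forall i, measurable_fun [set: T] (X ^~ i)) ->
    P [set w | all (fun u => u.2 < X w u.1) r] =
    (\int[P]_w ((all (fun u => u.2 < X w u.1) r)%:R * wave [::] 0 (X w)))%:E.
  move=> mX; rewrite -[LHS]fineK ?fin_num_measure//; last exact: mall.
  rewrite -[X in P X]setIT -integral_indic//; last exact: mall.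
  congr (fine _)%:E; apply: eq_integral => w _.
  rewrite /wave /lincomb big_nil addr0 cos0 mulr1 indicE; congr (_%:R)%:E.
  by congr nat_of_bool; apply/idP/idP => [/set_mem|/mem_set].
by rewrite !E// (indistinctE iG).
Qed.

End cramer_wold.

(** * Linear combinations of the white noise *)

Section lincomb_moments.
Context d (T : measurableType d) (R : realType) (P : probability T R) (I : Type).
Variable X : T -> I -> R.

Lemma integrable_lincomb (t : seq (R * I)) :
  (forall i, P.-integrable [set: T] (EFin \o X ^~ i)) ->
  P.-integrable [set: T] (EFin \o (fun w => lincomb t (X w))).
Proof.
move=> iX.
rewrite (_ : _ \o _ = (fun w => \sum_(u <- t) u.1%:E * (X w u.2)%:E)%E); last first.
  by apply/funext => w; rewrite /lincomb /= -sumEFin.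
by apply: integrable_sum => // u _; apply: integrableZl => //; exact: iX.
Qed.

Lemma Rintegral_lincomb (t : seq (R * I)) :
  (forall i, P.-integrable [set: T] (EFin \o X ^~ i)) ->
  \int[P]_w lincomb t (X w) = lincomb t (fun i => \int[P]_w X w i).
Proof.
move=> iX; elim: t => [|[a i] t IH].
  rewrite [RHS]/lincomb big_nil; under eq_Rintegral do rewrite /lincomb big_nil.
  by rewrite Rintegral_cst// mul0r.
rewrite lincomb_cons -IH; under eq_Rintegral do rewrite lincomb_cons.
rewrite RintegralD//=; last exact: integrable_lincomb.
  by rewrite RintegralZl//; exact: iX.
rewrite (_ : _ \o _ = (fun w => a%:E * (X w i)%:E)%E) //.
by apply: integrableZl => //; exact: iX.
Qed.

End lincomb_moments.

Section quadratic_form.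
Context (R : realType) (I : Type) (K : I -> I -> R).

Definition tensor (t t' : seq (R * I)) : seq (R * (I * I)) :=
  [seq (u.1 * v.1, (u.2, v.2)) | u <- t, v <- t'].

Definition quadform (t : seq (R * I)) := \sum_(u <- t) \sum_(v <- t) u.1 * v.1 * K u.2 v.2.

Lemma lincomb_tensor (t t' : seq (R * I)) (k : I -> I -> R) :
  lincomb (tensor t t') (fun ij => k ij.1 ij.2) =
  \sum_(u <- t) \sum_(v <- t') u.1 * v.1 * k u.2 v.2.
Proof. by rewrite /lincomb /tensor big_allpairs_dep. Qed.

Lemma lincombM (t t' : seq (R * I)) (x : I -> R) :
  lincomb t x * lincomb t' x = lincomb (tensor t t') (fun ij => x ij.1 * x ij.2).
Proof.
rewrite (lincomb_tensor _ _ (fun i j => x i * x j)) /lincomb big_distrl/=.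
apply: eq_bigr => u _; rewrite big_distrr/=; apply: eq_bigr => v _; ring.
Qed.

Lemma quadform_cons a i t : (forall i j, K i j = K j i) ->
  quadform ((a, i) :: t) = a ^+ 2 * K i i + 2 * a * lincomb t (K i) + quadform t.
Proof.
move=> KC; rewrite /quadform big_cons big_cons /=.
under [X in _ + X]eq_bigr do rewrite big_cons/=.
rewrite big_split/= addrA expr2; congr (_ + _); rewrite -addrA; congr (_ + _).
rewrite /lincomb big_distrr -big_split/=; apply: eq_bigr => u _.
by rewrite (KC u.2); ring.
Qed.
End quadratic_form.

Section white_noise_laws.
Context (R : realType) (p : nat) d (Omega : measurableType d) (P : probability Omega R).
Variable W : L2 (leb_cube R p) -> {RV P >-> R}.
Hypothesis white : is_white_noise W.

Local Notation noise := (fun w g => W g w).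
Local Notation K := (fun g h : L2 (leb_cube R p) => inner (leb_cube R p) g h).

Lemma innerC d' (T : measurableType d') (mu : {measure set T -> \bar R}) (f g : T -> R) :
  inner mu f g = inner mu g f.
Proof. by apply: eq_Rintegral => x _; rewrite mulrC. Qed.

Lemma measurable_noise g : measurable_fun [set: Omega] (noise ^~ g).
Proof. exact: (measurable_funPT (W g)). Qed.

Let noise_normal t : exists m v, 0 <= v /\
  normal_law P (fun w => lincomb t (noise w)) m (Num.sqrt v).
Proof.
apply: gaussian_normal_law.
  by apply: measurable_lincomb => g; exact: measurable_noise.
have [gau _ _] := white.
have -> : (fun w => lincomb t (noise w)) = (fun w => \sum_(i < size t)
    (tnth (in_tuple t) i).1 * W (tnth (in_tuple t) i).2 w).
  by apply/funext => w; rewrite /lincomb big_tnth.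
exact: gau.
Qed.

Lemma noise_Lfun2 g : (noise ^~ g) \in Lfun P 2%:E.
Proof.
have [m [v [_ law]]] := noise_normal [:: (1, g)].
have -> : noise ^~ g = (fun w => lincomb [:: (1, g)] (noise w)).
  by apply/funext => w; rewrite lincomb1 mul1r.
apply: normal_law_Lfun2 law.
by apply: measurable_lincomb => h; exact: measurable_noise.
Qed.

Let noise_Lfun1 g : (noise ^~ g) \in Lfun P 1.
Proof. by apply: (Lfun_subset12 _ (noise_Lfun2 g)); exact: fin_num_measure. Qed.

Lemma noise_integrable g : P.-integrable [set: Omega] (EFin \o noise ^~ g).
Proof. exact/Lfun1_integrable/noise_Lfun1. Qed.

Lemma noise_mean g : \int[P]_w noise w g = 0.
Proof.
have [_ mean _] := white; have := mean g.
by rewrite unlock => E; rewrite /Rintegral E.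
Qed.

Let noiseM_integrable g h :
  P.-integrable [set: Omega] (EFin \o (fun w => noise w g * noise w h)).
Proof. by apply/Lfun1_integrable; exact: (Lfun2_mul_Lfun1 (noise_Lfun2 g) (noise_Lfun2 h)). Qed.

Lemma noise_covariance g h : \int[P]_w (noise w g * noise w h) = K g h.
Proof.
have [_ mean cov] := white; have := cov g h.
rewrite covarianceE ?noise_Lfun1//; last by apply/Lfun1_integrable; exact: noiseM_integrable.
rewrite [X in (_ - X * _)%E]mean mul0e sube0 unlock => E.
by rewrite /Rintegral E.
Qed.

Lemma noise_quadform t : \int[P]_w (lincomb t (noise w) ^+ 2) = quadform K t.
Proof.
under eq_Rintegral do rewrite expr2 lincombM.
rewrite (@Rintegral_lincomb _ _ _ _ _ (fun w gh => noise w gh.1 * noise w gh.2)).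
  rewrite /quadform -(lincomb_tensor _ _ K); apply: eq_bigr => u _.
  by rewrite noise_covariance.
by move=> gh; exact: noiseM_integrable.
Qed.

Lemma quadform_ge0 t : 0 <= quadform K t.
Proof. by rewrite -noise_quadform; apply: Rintegral_ge0 => w _; exact: sqr_ge0. Qed.

Lemma noise_law t :
  normal_law P (fun w => lincomb t (noise w)) 0 (Num.sqrt (quadform K t)).
Proof.
have [m [v [v0 law]]] := noise_normal t.
have m0 : m = 0.
  have /(congr1 fine) /= <- := normal_law_mean law.
  rewrite -[LHS]/(\int[P]_w lincomb t (noise w)) Rintegral_lincomb; last exact: noise_integrable.
  by rewrite /lincomb big1// => u _; rewrite noise_mean mulr0.
suff -> : quadform K t = v by rewrite -m0.
have /(congr1 fine) /= := normal_law_sqr law.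
rewrite -[X in X = _ -> _]/(\int[P]_w (lincomb t (noise w) ^+ 2)) noise_quadform => ->.
by rewrite m0 expr0n add0r sqr_sqrtr.
Qed.

End white_noise_laws.

(** * The Cameron-Martin formula for the white noise *)

Section cylinder_sigma_algebra.
Variables (R : realType) (p : nat).
Local Notation L2c := (L2 (leb_cube R p)).
Local Notation Obs := (obs R p).

Lemma measurable_to_obs d (T : measurableType d) (Y : T -> Obs) :
  (forall g, measurable_fun [set: T] (fun w => Y w g)) -> measurable_fun [set: T] Y.
Proof.
move=> mY; apply: (@measurability _ _ T Obs [set: T] Y (@cylinders R p) erefl).
by move=> _ [_ [g [A [mA ->]]] <-]; exact: mY.
Qed.

Lemma measurable_obs_eval (g : L2c) : measurable_fun [set: Obs] (fun y : Obs => y g).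
Proof.
move=> _ A mA; rewrite setTI; apply: sub_sigma_algebra.
by exists g, A.
Qed.

Definition rays (r : seq (L2c * R)) : set (L2c -> R) :=
  [set y | all (fun u => u.2 < y u.1) r].

Lemma cylinders_sub_rays (A : set Obs) : measurable A -> <<s range rays >> A.
Proof.
apply: smallest_sub; first exact: smallest_sigma_algebra.
move=> _ [g [B [mB ->]]].
pose T := g_sigma_algebraType (range rays).
have : measurable_fun [set: T] (fun y : T => y g).
  apply: (measurability _ (RGenOInfty.measurableE R)).
  move=> _ [_ [a ->] <-]; rewrite setTI; apply: sub_sigma_algebra.
  exists [:: (g, a)] => //; apply/seteqP; split=> y /=; by rewrite in_itv/= !andbT.
by move=> /(_ measurableT B mB); rewrite setTI.
Qed.

Lemma measurable_rays r : measurable (rays r : set Obs).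
Proof.
elim: r => [|[g a] r IH].
  by rewrite (_ : rays _ = setT)//; apply/seteqP; split.
rewrite (_ : rays _ = ((fun y : Obs => y g) @^-1` `]a, +oo[) `&` rays r).
  apply: measurableI => //; rewrite -[X in measurable X]setTI.
  exact: measurable_obs_eval.
by apply/seteqP; split=> y; rewrite /rays /= in_itv/= andbT => /andP.
Qed.

(** The products of half-lines form a pi-system that generates the cylinder
    sigma-algebra, so [rays_indistinct] determines the law on all of it. *)
Lemma obs_law_unique d1 d2 (T1 : measurableType d1) (T2 : measurableType d2)
    (P1 : probability T1 R) (P2 : probability T2 R) (X1 : T1 -> Obs) (X2 : T2 -> Obs) :
  (forall g, measurable_fun [set: T1] (fun w => X1 w g)) ->
  (forall g, measurable_fun [set: T2] (fun w => X2 w g)) ->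
  (forall t b, \int[P1]_w cos (lincomb t (X1 w) + b) =
               \int[P2]_w cos (lincomb t (X2 w) + b)) ->
  forall H : Obs -> \bar R, measurable_fun [set: Obs] H -> (forall y, 0 <= H y)%E ->
  (\int[P1]_w H (X1 w) = \int[P2]_w H (X2 w))%E.
Proof.
move=> m1 m2 cosE H mH H0.
pose X1' := mfun_Sub (mem_set (measurable_to_obs m1)).
pose X2' := mfun_Sub (mem_set (measurable_to_obs m2)).
transitivity (\int[pushforward P1 X1']_y H y)%E.
  by rewrite ge0_integral_pushforward.
transitivity (\int[pushforward P2 X2']_y H y)%E; last first.
  by rewrite ge0_integral_pushforward.
apply: eq_measure_integral => A mA _.
apply: (@g_sigma_algebra_measure_unique _ R Obs (range rays) _ (fun=> rays [::])).
- by move=> _ [r _ <-]; exact: measurable_rays.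
- by move=> _; exists [::].
- by apply/seteqP; split=> // y _; exists 0%N.
- move=> _ _ [r _ <-] [r' _ <-]; exists (r ++ r') => //.
  by apply/seteqP; split=> y; rewrite /rays/= all_cat => /andP.
- move=> _ [r _ <-]; exact: (rays_indistinct m1 m2 cosE r).
- move=> _; apply: le_lt_trans (ltry (1 : R)).
  apply: (@probability_le1 _ _ _ P1).
  rewrite -[X in measurable X]setTI.
  exact: (measurable_to_obs m1 measurableT (measurable_rays [::])).
- exact: cylinders_sub_rays.
Qed.

End cylinder_sigma_algebra.

Section independent_copy.
Context d (Omega : measurableType d) (R : realType) (P : probability Omega R).
Local Notation gamma := (@normal_prob R 0 1).

Lemma ge0_integral_product_prob d2 (T2 : measurableType d2) (P2 : probability T2 R)
    (F : Omega * T2 -> \bar R) :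
  measurable_fun [set: Omega * T2] F -> (forall x, 0 <= F x)%E ->
  (\int[product_prob P P2]_x F x = \int[P]_w \int[P2]_z F (w, z))%E.
Proof. by move=> mF F0; rewrite -[RHS]fubini_tonelli1. Qed.

(** By independence, the integral over [z] is a function of [U] alone, to which
    [normal_law] applies; what remains is a convolution of normal laws. *)
Lemma normal_law_add (U : Omega -> R) s c : measurable_fun [set: Omega] U ->
  normal_law P U 0 s ->
  normal_law (product_prob P gamma) (fun x => U x.1 + c * x.2) 0
    (Num.sqrt (s ^+ 2 + c ^+ 2)).
Proof.
move=> mU lawU F mF F0.
rewrite ge0_integral_product_prob//=; last first.
  apply: measurableT_comp => //; apply: measurable_funD.
    exact: measurableT_comp.
  exact: measurable_funM.
pose H x := (\int[gamma]_z F (x + c * z)%R)%E.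
have mH : measurable_fun [set: R] H.
  apply: (@measurable_fun_fubini_tonelli_F _ _ _ _ _ gamma
    (fun z : R * R => F (z.1 + c * z.2))) => //.
  by apply: measurableT_comp => //; apply: measurable_funD => //; exact: measurable_funM.
rewrite -[LHS]/(\int[P]_w H (U w))%E lawU//; last by move=> x; exact: integral_ge0.
rewrite /H; under eq_integral => x _ do under eq_integral => z _ do rewrite add0r.
rewrite normal01_convolution//.
by apply: eq_integral => z _; rewrite add0r.
Qed.
End independent_copy.

Section cameron_martin.
Context (R : realType) (p : nat) d (Omega : measurableType d) (P : probability Omega R).
Variable W : L2 (leb_cube R p) -> {RV P >-> R}.
Hypothesis white : is_white_noise W.
Variables (n : nat) (f : L2 (leb_cube R p)).
Local Notation K := (fun g h : L2 (leb_cube R p) => inner (leb_cube R p) g h).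
Local Notation v := (K f f).
Hypotheses (n0 : (0 < n)%N) (v0 : 0 < v).
Local Notation noise := (fun w g => W g w).
Local Notation gamma := (@normal_prob R 0 1).
Local Notation Q := (product_prob P gamma).

(** The noise with its component along [f] replaced by an independent copy. *)
Definition resampled (x : Omega * measurableTypeR R) : obs R p :=
  fun g => W g x.1 + K g f / v * (Num.sqrt v * x.2 - W f x.1).

Let measurable_resampled g : measurable_fun setT (fun x => resampled x g).
Proof.
have m1 h : measurable_fun [set: Omega * measurableTypeR R] (fun x => W h x.1).
  by apply: measurableT_comp => //; exact: measurable_funPT.
apply: measurable_funD => //; apply: measurable_funM => //.
by apply: measurable_funB => //; exact: measurable_funM.
Qed.

Let lincomb_resampled t x : lincomb t (resampled x) =
  lincomb ((- (lincomb t (K f) / v), f) :: t) (noise x.1) +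
  lincomb t (K f) / v * Num.sqrt v * x.2.
Proof.
rewrite lincomb_cons.
have -> : lincomb t (resampled x) = lincomb t (noise x.1) +
    lincomb t (K f) / v * (Num.sqrt v * x.2 - W f x.1).
  rewrite /lincomb !big_distrl/= -big_split/=; apply: eq_bigr => u _.
  by rewrite /resampled (innerC _ f); ring.
by ring.
Qed.

(** Removing the projection [b W f] leaves a combination uncorrelated with
    [W f]; its variance falls by [b ^ 2 v], and the independent term
    [b (sqrt v) z] restores it. *)
Lemma resampled_law t :
  normal_law Q (fun x => lincomb t (resampled x)) 0 (Num.sqrt (quadform K t)).
Proof.
set b := lincomb t (K f) / v.
have := normal_law_add (b * Num.sqrt v)
  (measurable_lincomb ((- b, f) :: t) (@measurable_noise _ _ _ _ _ W)) (noise_law white _).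
rewrite sqr_sqrtr; last exact: (quadform_ge0 white).
rewrite (@quadform_cons _ _ K _ _ _ (fun g h => innerC _ g h)).
rewrite (_ : _ + _ + _ + _ = quadform K t).
  by move=> law F mF F0; rewrite -law//; apply: eq_integral => x _; rewrite lincomb_resampled.
have bv : lincomb t (K f) = b * v by rewrite /b divfK// gt_eqF.
by rewrite exprMn sqr_sqrtr ?ltW// bv; ring.
Qed.

Lemma resampledE (H : obs R p -> \bar R) :
  measurable_fun [set: obs R p] H -> (forall y, 0 <= H y)%E ->
  (\int[P]_w H (noise w) = \int[Q]_x H (resampled x))%E.
Proof.
apply: obs_law_unique => [g|g|t b]; [exact: measurable_noise|exact: measurable_resampled|].
have mcos : measurable_fun [set: R] (fun x : R => (cos (x + b))%:E).
  apply/measurable_EFinP.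
  apply: (measurableT_comp (continuous_measurable_fun (@continuous_cos R))).
  exact: measurable_funD.
congr fine.
by rewrite (normal_law_integral (noise_law white t) mcos)
           (normal_law_integral (resampled_law t) mcos).
Qed.

Let scale (c : L2 (leb_cube R p) -> R) (y : obs R p) : obs R p :=
  fun g => c g + (Num.sqrt n%:R)^-1 * y g.

Let measurable_scale c : measurable_fun setT (scale c).
Proof.
apply: measurable_to_obs => g; apply: measurable_funD => //.
by apply: measurable_funM => //; exact: measurable_obs_eval.
Qed.

(** On the resampled noise, adding the signal [f] amounts to translating the
    standard normal coordinate by [sqrt (n v)], and the weight is the
    corresponding likelihood ratio; the coordinate in [Omega] is a spectator. *)
Lemma cameron_martin (A : set (obs R p)) : measurable A ->
  law W n f A = (\int[P]_w ((\1_A (observe W n (null_signal R p) w))%:E *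
    (expR (Num.sqrt n%:R * W f w - n%:R * v / 2))%:E))%E.
Proof.
move=> mA.
have mind c : measurable_fun [set: obs R p] (fun y => (\1_A (scale c y))%:E : \bar R).
  apply/measurable_EFinP; apply: (measurableT_comp (measurable_indic mA)).
  exact: measurable_scale.
have n0R : 0 < Num.sqrt n%:R :> R by rewrite sqrtr_gt0 ltr0n.
transitivity (\int[P]_w (\1_A (scale (K^~ f) (noise w)))%:E)%E.
  pose Y w := scale (K^~ f) (noise w).
  have mY : measurable_fun [set: Omega] Y.
    apply: (measurableT_comp (measurable_scale (K^~ f))).
    by apply: measurable_to_obs => g; exact: measurable_noise.
  transitivity (\int[P]_w (\1_(Y @^-1` A) w)%:E)%E; last by [].
  rewrite integral_indic ?setIT//.
  by rewrite -[X in measurable X]setTI; exact: mY.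
rewrite (resampledE (mind _)); last by move=> y; rewrite lee_fin.
have mres : measurable_fun setT resampled.
  by apply: measurable_to_obs => g; exact: measurable_resampled.
rewrite ge0_integral_product_prob//; last exact: (measurableT_comp (mind _) mres).
pose H (y : obs R p) := ((\1_A (scale (fun=> 0) y))%:E *
  (expR (Num.sqrt n%:R * y f - n%:R * v / 2))%:E)%E.
have mH : measurable_fun [set: obs R p] H.
  apply: emeasurable_funM; first exact: mind.
  apply/measurable_EFinP; apply: measurableT_comp => //.
  apply: measurable_funB => //; apply: measurable_funM => //.
  exact: measurable_obs_eval.
have H0 y : (0 <= H y)%E by rewrite mule_ge0 ?lee_fin ?expR_ge0.
transitivity (\int[P]_w H (noise w))%E; last first.
  apply: eq_integral => w _; congr ((\1_A _)%:E * _)%E.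
  apply/funext => g; rewrite /scale /observe; congr (_ + _).
  rewrite /inner; under eq_Rintegral do rewrite mulr0.
  by rewrite Rintegral_cst// mul0r.
rewrite (resampledE mH)// ge0_integral_product_prob//; last first.
  exact: (measurableT_comp mH mres).
apply: eq_integral => w _.
have mG : measurable_fun [set: R] (fun z : R =>
   (\1_A (scale (fun=> 0) (resampled (w, z))))%:E : \bar R).
  apply: (measurableT_comp (mind _)); apply: measurable_to_obs => g.
  apply: measurable_funD => //=; apply: measurable_funM => //.
  exact: measurable_funB.
transitivity (\int[gamma]_z (\1_A (scale (fun=> 0)
    (resampled (w, Num.sqrt n%:R * Num.sqrt v + z)%R)))%:E)%E.
  apply: eq_integral => z _; congr (\1_A _)%:E; apply/funext => g.
  rewrite /scale /resampled /= add0r.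
  set m := Num.sqrt n%:R; set r := Num.sqrt v.
  have r0 : 0 < r by rewrite sqrtr_gt0.
  have -> : v = r ^+ 2 by rewrite sqr_sqrtr// ltW.
  by field; rewrite !gt_eqF.
rewrite -(ge0_integral_normal01_shift _ mG)//.
apply: eq_integral => z _; rewrite /H; congr (_ * (expR _)%:E)%E.
rewrite /resampled /= divff ?gt_eqF// mul1r.
have -> : (Num.sqrt n%:R * Num.sqrt v) ^+ 2 = n%:R * v.
  by rewrite exprMn !sqr_sqrtr// ltW.
by ring.
Qed.
End cameron_martin.

(** * From the chi-square distance to the testing risk *)

Section likelihood.
Context (R : realType) (p : nat) d (Omega : measurableType d) (P : probability Omega R).
Variable W : L2 (leb_cube R p) -> {RV P >-> R}.
Hypothesis white : is_white_noise W.
Variables (n : nat).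
Hypothesis n0 : (0 < n)%N.
Local Notation K := (fun g h : L2 (leb_cube R p) => inner (leb_cube R p) g h).

Definition likelihood (f : L2 (leb_cube R p)) w :=
  expR (Num.sqrt n%:R * W f w - n%:R * K f f / 2).

Lemma measurable_likelihood f : measurable_fun [set: Omega] (likelihood f).
Proof.
apply: measurableT_comp => //; apply: measurable_funB => //.
by apply: measurable_funM => //; exact: measurable_funPT.
Qed.

Lemma likelihood_ge0 f w : 0 <= likelihood f w. Proof. exact: expR_ge0. Qed.

Let expR_noise t :
  (\int[P]_w (expR (lincomb t (fun g => W g w)))%:E = (expR (quadform K t / 2))%:E)%E.
Proof.
rewrite (normal_law_expR (noise_law white t))// sqr_sqrtr//.
exact: (quadform_ge0 white).
Qed.

Lemma integral_likelihood f : (\int[P]_w (likelihood f w)%:E = 1)%E.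
Proof.
have := expR_noise [:: (Num.sqrt n%:R, f)].
under eq_integral do rewrite lincomb1.
rewrite (@quadform_cons _ _ K _ _ _ (fun g h => innerC _ g h)).
rewrite /quadform /lincomb !big_nil mulr0 !addr0 sqr_sqrtr// => E.
rewrite /likelihood; under eq_integral do rewrite expRD EFinM.
rewrite ge0_integralZr//.
- by rewrite E -EFinM -expRD subrr expR0.
- apply/measurable_EFinP; apply: measurableT_comp => //.
  by apply: measurable_funM => //; exact: measurable_funPT.
Qed.

(** The two norms cancel in the exponent and only the cross term survives. *)
Lemma integral_likelihoodM f g :
  (\int[P]_w (likelihood f w * likelihood g w)%:E = (expR (n%:R * K f g))%:E)%E.
Proof.
have := expR_noise [:: (Num.sqrt n%:R, f); (Num.sqrt n%:R, g)].
under eq_integral do rewrite lincomb_cons lincomb1.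
rewrite !(@quadform_cons _ _ K _ _ _ (fun g h => innerC _ g h)) lincomb1.
rewrite /quadform /lincomb !big_nil mulr0 !addr0 sqr_sqrtr// => E.
have LL w : likelihood f w * likelihood g w =
    expR (Num.sqrt n%:R * W f w + Num.sqrt n%:R * W g w) *
    expR (- (n%:R * K f f / 2 + n%:R * K g g / 2)).
  by rewrite /likelihood -!expRD; congr expR; ring.
under eq_integral do rewrite LL EFinM.
rewrite ge0_integralZr//=.
- rewrite E -EFinM -expRD; congr (expR _)%:E.
  have : Num.sqrt n%:R ^+ 2 = n%:R :> R by rewrite sqr_sqrtr.
  by move: (Num.sqrt _) => m <-; field.
- apply/measurable_EFinP; apply: measurableT_comp => //.
  by apply: measurable_funD; apply: measurable_funM => //; exact: measurable_funPT.
Qed.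

Lemma integrable_likelihood f : P.-integrable [set: Omega] (EFin \o likelihood f).
Proof.
apply/integrableP; split; first exact/measurable_EFinP/measurable_likelihood.
under eq_integral do rewrite /= ger0_norm ?likelihood_ge0//.
by rewrite integral_likelihood ltry.
Qed.

Lemma integrable_likelihoodM f g :
  P.-integrable [set: Omega] (EFin \o (fun w => likelihood f w * likelihood g w)).
Proof.
apply/integrableP; split.
  by apply/measurable_EFinP/measurable_funM; exact: measurable_likelihood.
under eq_integral do rewrite /= ger0_norm ?mulr_ge0 ?likelihood_ge0//.
by rewrite integral_likelihoodM ltry.
Qed.

Variables (I : finType) (f : I -> L2 (leb_cube R p)) (eta : R).
Hypotheses (f0 : forall i, 0 < K (f i) (f i)) (eta0 : 0 < eta).
Hypothesis I0 : (0 < #|I|)%N.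
Hypothesis chi2 :
  \sum_i \sum_j expR (n%:R * K (f i) (f j)) <= #|I|%:R ^+ 2 * (1 + eta ^+ 2).

Let N : R := #|I|%:R.
Let t := [seq (N^-1, i) | i <- enum I].

Let N0 : 0 < N. Proof. by rewrite ltr0n. Qed.

Let lincombE x : lincomb t x = N^-1 * \sum_i x i.
Proof. by rewrite /lincomb big_map big_enum mulr_sumr. Qed.

Let L w i := likelihood (f i) w.

Let Lbar w := lincomb t (L w).

(** The second moment of the mixture likelihood controls both errors at once:
    [X (1 - L) <= (eta + (1 - L) ^ 2 / eta) / 2] when [0 <= X <= 1]. *)
Lemma mixture_testing_bound (A : set (obs R p)) : measurable A ->
  1 - eta <= fine (law W n (null_signal R p) (~` A)) +
             N^-1 * \sum_i fine (law W n (f i) A).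
Proof.
move=> mA.
pose X w : R := \1_A (observe W n (null_signal R p) w).
have mX : measurable_fun [set: Omega] X.
  apply: (measurableT_comp (measurable_indic mA)).
  exact: (measurable_funPT (observe W n (null_signal R p))).
have X01 w : X w = 0 \/ X w = 1 by rewrite /X indicE; case: (_ \in _); [right|left].
have iX : P.-integrable [set: Omega] (EFin \o X).
  apply: (@integrable_bounded _ _ _ P _ 1) => // w.
  by case: (X01 w) => ->; rewrite ?normr0 ?normr1.
have mL i : measurable_fun [set: Omega] (L ^~ i) by exact: measurable_likelihood.
have iL i : P.-integrable [set: Omega] (EFin \o L ^~ i) by exact: integrable_likelihood.
have iXL i : P.-integrable [set: Omega] (EFin \o (fun w => X w * L w i)).
  apply: (le_integrable measurableT _ _ (iL i)).
    by apply/measurable_EFinP; exact: measurable_funM.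
  move=> w _ /=; rewrite lee_fin normrM.
  by case: (X01 w) => ->; rewrite ?normr0 ?normr1 ?mul0r ?mul1r.
have iLL ij : P.-integrable [set: Omega] (EFin \o (fun w => L w ij.1 * L w ij.2)).
  exact: integrable_likelihoodM.
have lawA i : fine (law W n (f i) A) = \int[P]_w (X w * L w i).
  rewrite (cameron_martin white n0 (f0 i) mA) /Rintegral.
  by congr fine; apply: eq_integral => w _; rewrite EFinM.
have law0 : fine (law W n (null_signal R p) (~` A)) = 1 - \int[P]_w X w.
  rewrite probability_setC// fineB ?fin_num_measure//; congr (_ - _).
  rewrite /law /distribution /pushforward /Rintegral; congr fine.
  transitivity (\int[P]_w (\1_(observe W n (null_signal R p) @^-1` A) w)%:E)%E => //.
  rewrite integral_indic ?setIT//; rewrite -[X in measurable X]setTI.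
  exact: (measurable_funPT (observe W n (null_signal R p))).
have iLbar : P.-integrable [set: Omega] (EFin \o Lbar) by exact: integrable_lincomb.
have Lbar1 : \int[P]_w Lbar w = 1.
  rewrite Rintegral_lincomb// lincombE (eq_bigr (fun=> 1)) => [|i _].
    by rewrite sumr_const -/N mulVf// gt_eqF.
  by rewrite /Rintegral integral_likelihood.
have Lbar2E : (fun w => Lbar w ^+ 2) =
    (fun w => lincomb (tensor t t) (fun ij => L w ij.1 * L w ij.2)).
  by apply/funext => w; rewrite expr2; exact: lincombM.
have iLbar2 : P.-integrable [set: Omega] (EFin \o (fun w => Lbar w ^+ 2)).
  by rewrite Lbar2E; exact: (integrable_lincomb (X := fun w ij => L w ij.1 * L w ij.2)).
have Lbar2 : \int[P]_w (Lbar w ^+ 2) <= 1 + eta ^+ 2.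
  rewrite Lbar2E (Rintegral_lincomb (X := fun w ij => L w ij.1 * L w ij.2))//.
  have -> : (fun ij => \int[P]_w (L w ij.1 * L w ij.2)) =
      (fun ij => expR (n%:R * K (f ij.1) (f ij.2))).
    by apply/funext => ij; rewrite /Rintegral integral_likelihoodM.
  rewrite (lincomb_tensor _ _ (fun i j => expR (n%:R * K (f i) (f j)))).
  rewrite big_map big_enum/=; under eq_bigr do rewrite big_map big_enum/= -mulr_sumr.
  rewrite -mulr_sumr -invfM -ler_pdivlMl ?invr_gt0 ?mulr_gt0// invrK -expr2.
  exact: chi2.
have XLbar : N^-1 * \sum_i fine (law W n (f i) A) = \int[P]_w (X w * Lbar w).
  under eq_bigr do rewrite lawA.
  rewrite -lincombE -(Rintegral_lincomb (X := fun w i => X w * L w i))//.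
  apply: eq_Rintegral => w _; rewrite /Lbar !lincombE [RHS]mulrCA.
  by congr (_ * _); rewrite mulr_sumr.
have iXLbar : P.-integrable [set: Omega] (EFin \o (fun w => X w * Lbar w)).
  apply: (le_integrable measurableT _ _ iLbar).
    by apply/measurable_EFinP; apply: measurable_funM => //; exact: measurable_lincomb.
  move=> w _ /=; rewrite lee_fin normrM.
  by case: (X01 w) => ->; rewrite ?normr0 ?normr1 ?mul0r ?mul1r.
rewrite law0 XLbar.
suff H : \int[P]_w (X w - X w * Lbar w) <= eta.
  by move: H; rewrite RintegralB//; lra.
(* the pointwise bound is expanded as a polynomial in Lbar *)
pose c1 := - eta^-1; pose c2 := (2 * eta)^-1.
have iZ c (h : Omega -> R) : P.-integrable [set: Omega] (EFin \o h) ->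
    P.-integrable [set: Omega] (EFin \o (fun w => c * h w)).
  move=> hi; rewrite (_ : _ \o _ = (fun w => c%:E * (h w)%:E)%E)//.
  exact: integrableZl.
have [c0 c0E] : exists c0, c0 = eta / 2 + c2 by exists (eta / 2 + c2).
have ic : P.-integrable [set: Omega] (EFin \o cst c0).
  exact: finite_measure_integrable_cst.
have iD (h k : Omega -> R) : P.-integrable [set: Omega] (EFin \o h) ->
    P.-integrable [set: Omega] (EFin \o k) ->
    P.-integrable [set: Omega] (EFin \o (fun w => h w + k w)).
  move=> ih ik; rewrite (_ : _ \o _ = (fun w => (h w)%:E + (k w)%:E)%E)//.
  exact: integrableD.
apply: (@le_trans _ _ (\int[P]_w (c0 + (c1 * Lbar w + c2 * Lbar w ^+ 2)))).
  apply: le_Rintegral => //.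
  - rewrite (_ : _ \o _ = (fun w => (X w)%:E - (X w * Lbar w)%:E)%E)//.
    exact: integrableB.
  - by apply: (iD _ _ ic); apply: iD; exact: iZ.
  move=> w _; have -> : c0 + (c1 * Lbar w + c2 * Lbar w ^+ 2) =
      2^-1 * (eta + (1 - Lbar w) ^+ 2 / eta).
    by rewrite c0E /c1 /c2; field; rewrite gt_eqF.
  have q0 : 0 <= (1 - Lbar w) ^+ 2 / eta by rewrite divr_ge0 ?sqr_ge0 ?ltW.
  case: (X01 w) => ->; first by rewrite mul0r subrr mulr_ge0// addr_ge0// ltW.
  rewrite mul1r -subr_ge0; have -> : 2^-1 * (eta + (1 - Lbar w) ^+ 2 / eta) - (1 - Lbar w) =
    (eta - (1 - Lbar w)) ^+ 2 / (2 * eta) by field; rewrite gt_eqF.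
  by rewrite divr_ge0 ?sqr_ge0// mulr_ge0// ltW.
have iZ1 := iZ c1 _ iLbar; have iZ2 := iZ c2 _ iLbar2.
rewrite RintegralD//; last exact: iD.
rewrite RintegralD//.
rewrite !RintegralZl// Lbar1 Rintegral_cst// mulr1.
rewrite [X in fine X](@probability_setT _ _ _ P) mulr1.
have c20 : 0 < c2 by rewrite invr_gt0 mulr_gt0.
apply: (@le_trans _ _ (c0 + (c1 + c2 * (1 + eta ^+ 2)))).
  by rewrite lerD2l lerD2l ler_pM2l.
by rewrite le_eqVlt; apply/orP; left; apply/eqP; rewrite c0E /c1 /c2; field; rewrite gt_eqF.
Qed.
End likelihood.

(** * Additive signals on the cube *)

Lemma integral_same_law d1 d2 (T1 : measurableType d1) (T2 : measurableType d2)
    (R : realType) (mu : {measure set T1 -> \bar R})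
    (nu : {measure set T2 -> \bar R}) (X : T1 -> T2) :
  measurable_fun [set: T1] X ->
  (forall A, measurable A -> mu (X @^-1` A) = nu A) ->
  forall F : T2 -> \bar R, measurable_fun [set: T2] F ->
    (\int[mu]_x F (X x) = \int[nu]_y F y)%E.
Proof.
move=> mX XE F mF.
pose X' := mfun_Sub (mem_set mX).
have ge0 G : measurable_fun [set: T2] G -> (forall y, 0 <= G y)%E ->
    (\int[mu]_x G (X x) = \int[nu]_y G y)%E.
  move=> mG G0; transitivity (\int[pushforward mu X']_y G y)%E.
    by rewrite ge0_integral_pushforward.
  by apply: eq_measure_integral => A mA _; exact: XE.
rewrite integralE [RHS]integralE; congr (_ - _)%E.
- rewrite -ge0//; last exact: measurable_funepos.
  by apply: eq_integral => w _; rewrite !funeposE.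
- rewrite -ge0//; last exact: measurable_funeneg.
  by apply: eq_integral => w _; rewrite !funenegE.
Qed.

Section cube.
Variable R : realType.
Local Notation I01 := (leb1 R).
Local Notation cube := (leb_cube R).
Local Notation RM := (measurableTypeR R).

Lemma leb_cube_marginal p (j : 'I_p) (A : set RM) : measurable A ->
  cube p [set x | A (tnth x j)] = I01 A.
Proof.
move=> mA; elim: p j => [[]//|p IH] j.
transitivity ((I01 \x cube p)%E
  [set x : RM * p.-tuple RM | A (tnth [tuple of x.1 :: x.2] j)]) => //.
case: (unliftP ord0 j) => [j' ->|->].
  rewrite (_ : [set _ | _] = setT `*` [set x | A (tnth x j')]).
    rewrite product_measure1E//; last first.
      by rewrite -[X in measurable X]setTI; exact: measurable_tnth.
    by rewrite [X in (X * _)%E](@probability_setT _ _ _ I01) mul1e; exact: IH.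
  by apply/seteqP; split=> x /=; rewrite tnthS => // -[].
rewrite (_ : [set _ | _] = A `*` setT).
  by rewrite product_measure1E// [X in (_ * X)%E](@probability_setT _ _ _ (cube p)) mule1.
by apply/seteqP; split=> x /=; rewrite tnth0 => // -[].
Qed.

Lemma leb_cube_marginal2 p (i j : 'I_p) (A B : set RM) : i != j ->
  measurable A -> measurable B ->
  cube p [set x | A (tnth x i) /\ B (tnth x j)] = (I01 A * I01 B)%E.
Proof.
move=> + mA mB; elim: p i j => [[]//|p IH] i j ij.
transitivity ((I01 \x cube p)%E [set x : RM * p.-tuple RM | A (tnth [tuple of x.1 :: x.2] i) /\
   B (tnth [tuple of x.1 :: x.2] j)]) => //.
have mt (k : 'I_p) (C : set RM) : measurable C ->
    measurable [set x : p.-tuple RM | C (tnth x k)].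
  by move=> mC; rewrite -[X in measurable X]setTI; exact: measurable_tnth.
case: (unliftP ord0 i) ij => [i' ->|->]; case: (unliftP ord0 j) => [j' ->|->] ij.
- rewrite (_ : [set _ | _] = setT `*` [set x | A (tnth x i') /\ B (tnth x j')]).
    rewrite product_measure1E//; last by apply: measurableI; exact: mt.
    rewrite [X in (X * _)%E](@probability_setT _ _ _ I01) mul1e; apply: IH.
    by apply: contra_neq ij => ->.
  by apply/seteqP; split=> x /=; rewrite !tnthS => // -[].
- rewrite (_ : [set _ | _] = B `*` [set x | A (tnth x i')]).
    rewrite product_measure1E//; last exact: mt.
    by rewrite [X in (_ * X)%E](leb_cube_marginal _ mA) muleC.
  by apply/seteqP; split=> x /=; rewrite tnthS tnth0 => -[].
- rewrite (_ : [set _ | _] = A `*` [set x | B (tnth x j')]).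
    rewrite product_measure1E//; last exact: mt.
    by rewrite [X in (_ * X)%E](leb_cube_marginal _ mB).
  by apply/seteqP; split=> x /=; rewrite tnthS tnth0 => -[].
- by rewrite eqxx in ij.
Qed.

Variables (p : nat).

Definition along (j : 'I_p) (h : R -> R) (x : p.-tuple RM) : R := h (tnth x j).

Lemma measurable_along j (h : L2 I01) : measurable_fun [set: p.-tuple RM] (along j h).
Proof.
by apply: (measurableT_comp (measurable_funPT h)); exact: measurable_tnth.
Qed.

Lemma along_Lfun2 j (h : L2 I01) : along j h \in Lfun (cube p) 2%:E.
Proof.
apply: Lfun2_sqr; first exact: measurable_along.
have sqr_h := Lfun2_integrable_sqr (LfunP h).
rewrite (integral_same_law (measurable_tnth j) (leb_cube_marginal j)
  (measurable_int _ sqr_h)).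
exact: integral_fune_lt_pinfty.
Qed.

Lemma inner_along j (h k : L2 I01) : inner (cube p) (along j h) (along j k) = inner I01 h k.
Proof.
congr fine.
have hk := Lfun2_mul_Lfun1 (LfunP h) (LfunP k).
have /Lfun1_integrable/measurable_int mhk := hk.
exact: (integral_same_law (measurable_tnth j) (leb_cube_marginal j) mhk).
Qed.

(** Two coordinates of the cube are independent, so centering kills the cross
    terms between components. *)
Lemma inner_along_distinct i j (h k : L2 I01) : i != j ->
  \int[I01]_x k x = 0 -> inner (cube p) (along i h) (along j k) = 0.
Proof.
move=> ij k0.
have mh : measurable_fun [set: RM] h by exact: measurable_funPT.
have mk : measurable_fun [set: RM] k by exact: measurable_funPT.
have l1 (g : L2 I01) : I01.-integrable [set: RM] (EFin \o g).
  apply/Lfun1_integrable.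
  by apply: (Lfun_subset12 _ (LfunP g)); exact: fin_num_measure.
have k0E : (\int[I01]_x (k x)%:E = 0)%E.
  move: k0; rewrite /Rintegral => E; rewrite -[LHS]fineK ?E//.
  by apply: integrable_fin_num => //; exact: l1.
pose X (x : p.-tuple RM) := (tnth x i, tnth x j).
have mX : measurable_fun [set: p.-tuple RM] X.
  by apply/measurable_fun_pairP; split; exact: measurable_tnth.
pose X' := mfun_Sub (mem_set mX).
pose F (z : RM * RM) := (h z.1 * k z.2)%:E.
have mF : measurable_fun [set: RM * RM] F.
  by apply/measurable_EFinP; apply: measurable_funM; exact: measurableT_comp.
have XE A : measurable A -> cube p (X @^-1` A) = (I01 \x I01)%E A.
  move=> mA; apply/esym.
  apply: (product_measure_unique (m' := pushforward (cube p) X')) => // B C mB mC.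
  exact: (leb_cube_marginal2 ij mB mC).
have iF : (I01 \x I01)%E.-integrable [set: RM * RM] F.
  apply/(integrable12ltyP _ _ mF).
  have /integrableP[_ hoo] := l1 h; have /integrableP[_ koo] := l1 k.
  under eq_integral => x _.
    under eq_integral => y _ do rewrite /F/= normrM EFinM.
    rewrite ge0_integralZl//; last exact/measurable_EFinP/measurableT_comp.
    over.
  rewrite ge0_integralZr//=; last 2 first.
  - exact/measurable_EFinP/measurableT_comp.
  - exact: integral_ge0.
  rewrite lte_mul_pinfty//; first exact: integral_ge0.
  by rewrite ge0_fin_numE//; exact: integral_ge0.
rewrite /inner /Rintegral (integral_same_law mX XE mF) -integral12_prod_meas1//.
rewrite /fubini_F integral0_eq// => x _.
rewrite /F/=; under eq_integral do rewrite EFinM.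
rewrite integralZl//; last exact: l1.
by rewrite k0E mule0.
Qed.
End cube.

Section signals.
Variables (R : realType) (p : nat) (psi : nat -> L2 (leb1 R)).
Local Notation cube := (leb_cube R p).

Definition additive_fun (K : nat) (Theta : nat -> 'I_p -> R)
    (x : p.-tuple (measurableTypeR R)) : R :=
  \sum_(i : 'I_K * 'I_p) Theta i.1 i.2 * along i.2 (psi i.1) x.

Lemma additive_fun_Lfun2 K Theta : additive_fun K Theta \in Lfun cube 2%:E.
Proof.
rewrite (_ : additive_fun K Theta =
  \sum_(i : 'I_K * 'I_p) Theta i.1 i.2 *: along i.2 (psi i.1)).
  have [Lfun0 linL] := Lfun_submod_closed cube (lee1n 2).
  apply: (big_rec (fun f => f \in Lfun cube 2%:E)) => // i f _ fL.
  by apply: linL => //; exact: along_Lfun2.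
by apply/funext => x; rewrite fct_sumE.
Qed.

Definition signal K Theta : L2 cube := Lfun_Sub (lee1n 2) (additive_fun_Lfun2 K Theta).

Hypothesis ortho : orthonormal_centered psi.

Lemma inner_signal K Theta Theta' :
  inner cube (signal K Theta) (signal K Theta') =
  \sum_(i : 'I_K * 'I_p) Theta i.1 i.2 * Theta' i.1 i.2.
Proof.
pose t (Th : nat -> 'I_p -> R) :=
  map (fun i : 'I_K * 'I_p => (Th i.1 i.2, i)) (enum {: 'I_K * 'I_p}).
pose X x (i : 'I_K * 'I_p) := along i.2 (psi i.1) x.
have tE Th x : additive_fun K Th x = lincomb (t Th) (X x).
  by rewrite /lincomb big_map big_enum.
rewrite /inner; under eq_Rintegral do rewrite /signal/= !tE lincombM.
rewrite (Rintegral_lincomb (X := fun x ij => X x ij.1 * X x ij.2)); last first.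
  move=> ij; apply/Lfun1_integrable.
  by apply: (@Lfun2_mul_Lfun1 _ _ _ cube); exact: along_Lfun2.
rewrite (lincomb_tensor _ _ (fun i j => \int[cube]_x (X x i * X x j))).
rewrite big_map big_enum/=; apply: eq_bigr => i _.
rewrite big_map big_enum/= (bigD1 i)//= big1 ?addr0 => [|j ji].
  by rewrite [X in _ * X]inner_along (proj1 ortho) eqxx mulr1.
have [ij|ij] := eqVneq i.2 j.2.
  rewrite /X ij [X in _ * X]inner_along (proj1 ortho).
  rewrite (_ : (_ == _) = false) ?mulr0//; apply/negbTE.
  by apply: contra_neq ji => /val_inj; case: i j ij => [? ?] [? ?] /= -> ->.
by rewrite [X in _ * X]inner_along_distinct ?mulr0//; exact: (proj2 ortho).
Qed.

Lemma norm2_L2 (f : L2 cube) : norm2 cube f = (Num.sqrt (inner cube f f))%:E.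
Proof.
have sqr_f := Lfun2_integrable_sqr (LfunP f).
rewrite /norm2 Lnorm2E -powR12_sqrt; last first.
  by apply: Rintegral_ge0 => x _; rewrite -expr2 sqr_ge0.
rewrite -poweR_EFin /inner /Rintegral fineK//.
exact: integrable_fin_num.
Qed.

Lemma signal_fun_class K Theta s alpha :
  (forall k j, (K <= k)%N -> Theta k j = 0) ->
  coef_class s alpha Theta -> fun_class psi s alpha (signal K Theta).
Proof.
move=> supp cls; exists Theta => //.
apply: cvg_near_cst; exists K => // N /= KN.
rewrite (_ : (fun x => _) = cst 0); first by rewrite /norm2 Lnorm0// eqe pnatr_eq0.
apply/funext => x; rewrite /signal /=; apply/eqP; rewrite subr_eq0; apply/eqP.
rewrite /additive_fun -(pair_big xpredT xpredT
  (fun (k : 'I_K) (j : 'I_p) => Theta k j * along j (psi k) x))/= exchange_big/=.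
apply: eq_bigr => j _; rewrite (@big_cat_nat _ _ _ K)//= big_mkord.
rewrite -[LHS]addr0; congr (_ + _); apply/esym.
by rewrite big_nat big1// => k /andP[Kk _]; rewrite supp// mul0r.
Qed.
End signals.

(** * Random signs *)

Section exponential_bounds.
Variable R : realType.
Implicit Types x q b : R.

(** Convexity between [0] and [x], derived from [1 + y <= expR y] at
    [(1 - q) x] and at [- q x]. *)
Lemma expR_chord q x : 0 <= q <= 1 -> expR (q * x) <= 1 + q * (expR x - 1).
Proof.
move=> /andP[q0 q1].
have e0 := expR_gt0 (q * x).
have up : expR (q * x) * (1 + (1 - q) * x) <= expR x.
  rewrite [leRHS](_ : _ = expR (q * x) * expR ((1 - q) * x)).
    by rewrite ler_pM2l// expR_ge1Dx.
  by rewrite -expRD; congr expR; ring.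
have down : expR (q * x) * (1 - q * x) <= 1.
  rewrite -[leRHS](expR0 R) [leRHS](_ : _ = expR (q * x) * expR (- (q * x))).
    by rewrite ler_pM2l// expR_ge1Dx.
  by rewrite -expRD subrr.
by nra.
Qed.

(** For small [b], the bounds [expR (+- b) <= 1 / (1 -+ b)] add up to
    [2 / (1 - b ^ 2)]; for large [b], already [`|b| <= 2 b ^ 2]. *)
Lemma cosh_le b : expR b + expR (- b) <= 2 * expR (2 * b ^+ 2).
Proof.
have [b2|b2] := lerP (b ^+ 2) 2^-1.
  have b1 : -1 < b < 1 by apply/andP; split; nra.
  have /andP[bN1 b1'] := b1.
  have e1 : expR b <= (1 - b)^-1.
    rewrite -[expR b]invrK -expRN lef_pV2 ?posrE ?expR_gt0 ?subr_gt0//.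
    exact: expR_ge1Dx.
  have e2 : expR (- b) <= (1 + b)^-1.
    rewrite -[expR (- b)]invrK -expRN opprK lef_pV2 ?posrE ?expR_gt0//; last by lra.
    exact: expR_ge1Dx.
  apply: le_trans (lerD e1 e2) _.
  have -> : (1 - b)^-1 + (1 + b)^-1 = 2 * (1 - b ^+ 2)^-1.
    by field; rewrite ?andbT; apply/and3P; split; rewrite ?gt_eqF//; nra.
  rewrite ler_pM2l// -[leRHS]invrK lef_pV2 ?posrE ?invr_gt0 ?expR_gt0//; last by nra.
  have e3 := expR_ge1Dx (2 * b ^+ 2).
  rewrite -[leLHS]div1r ler_pdivrMr ?expR_gt0//.
  have := sqr_ge0 b; nra.
have le c : c ^+ 2 = b ^+ 2 -> expR c <= expR (2 * b ^+ 2).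
  by move=> cb; rewrite ler_expR -cb; move: b2; rewrite -cb; nra.
by rewrite mulr_natl mulr2n lerD// le// sqrrN.
Qed.

Definition signb (e : bool) : R := (-1) ^+ e.

Lemma signb_sqr e : signb e ^+ 2 = 1. Proof. by rewrite /signb sqrr_sign. Qed.

(** Averaging over independent signs, coordinate by coordinate. *)
Lemma rademacher_expR (B : finType) (b : B -> R) :
  \sum_(e : {ffun B -> bool}) expR (\sum_i b i * signb (e i)) <=
  2 ^+ #|B| * expR (2 * \sum_i b i ^+ 2).
Proof.
under eq_bigr do rewrite expR_sum.
rewrite -(bigA_distr_bigA (fun (i : B) e => expR (b i * signb e)))/=.
rewrite mulr_sumr expR_sum -prodr_const -big_split/=.
apply: ler_prod => i _; rewrite big_bool /signb expr1 expr0 mulrN1 mulr1.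
by rewrite addr_ge0 ?expR_ge0//= addrC cosh_le.
Qed.

Definition gap (i j : nat) := ((i - j) + (j - i))%N.

Lemma sum_geometric_gap i m : \sum_(j < m) (2^-1 : R) ^+ gap i j <= 3.
Proof.
have left k : (k <= i)%N -> \sum_(j < k) (2^-1 : R) ^+ gap i j <= 2^-1 ^+ (i - k).
  elim: k => [_|k IH ki]; first by rewrite big_ord0 exprn_ge0.
  rewrite big_ord_recr/=; apply: le_trans (lerD (IH (ltnW ki)) (lexx _)) _.
  rewrite /gap (eqP (ltnW ki : (k - i == 0)%N)) addn0.
  by rewrite -(subnSK ki) exprS; lra.
have right k : \sum_(j < i.+1 + k) (2^-1 : R) ^+ gap i j <= 3 - 2^-1 ^+ k.
  elim: k => [|k IH].
    rewrite addn0 big_ord_recr/= /gap subnn !expr0.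
    by have := left i (leqnn i); rewrite subnn expr0; lra.
  rewrite addnS big_ord_recr/=; apply: le_trans (lerD IH (lexx _)) _.
  rewrite /gap addSnnS subnDA subnn sub0n add0n addKn.
  by rewrite exprS; lra.
have [im|im] := leqP m i.
  by apply: le_trans (left _ im) _; rewrite (@le_trans _ _ 1) ?ler1n// exprn_ile1//; lra.
by rewrite -(subnKC im); apply: le_trans (right _) _; rewrite gerBl exprn_ge0.
Qed.

(** By convexity each term exceeds [1] by at most a geometric factor in the
    gap, and these factors are summable in [j]. *)
Lemma sum_expR_gap x m : 0 <= x ->
  \sum_(i < m) \sum_(j < m) expR (x * 2^-1 ^+ gap i j) <=
  m%:R ^+ 2 + 3 * m%:R * (expR x - 1).
Proof.
move=> x0.
have e0 : 0 <= expR x - 1 by rewrite subr_ge0 -expR0 ler_expR.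
apply: (@le_trans _ _ (\sum_(i < m) (m%:R + 3 * (expR x - 1)))); last first.
  by rewrite sumr_const card_ord -mulr_natl; lra.
apply: ler_sum => i _.
apply: (@le_trans _ _ (\sum_(j < m) (1 + 2^-1 ^+ gap i j * (expR x - 1)))).
  apply: ler_sum => j _; rewrite mulrC; apply: expR_chord.
  by rewrite exprn_ge0// exprn_ile1//; lra.
rewrite big_split/= sumr_const card_ord -mulr_suml lerD2l.
by rewrite ler_wpM2r// sum_geometric_gap.
Qed.

End exponential_bounds.

Section rademacher_signals.
Variables (R : realType) (p : nat) (psi : nat -> L2 (leb1 R)).
Hypothesis ortho : orthonormal_centered psi.
Variable K : nat.
Local Notation cell := ('I_K * 'I_p)%type.

(** The signs live on a finite set of [K] frequencies, common to all draws, so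
    that the priors of different cutoffs [k0] share one index type. *)
Definition random_coef (r : R) (k0 : nat) (e : {ffun cell -> bool})
    (k : nat) (j : 'I_p) : R :=
  if (k < k0)%N then r * oapp (fun k' : 'I_K => signb R (e (k', j))) 0 (insub k) else 0.

Lemma random_coefE r k0 e (x : cell) :
  random_coef r k0 e x.1 x.2 = (x.1 < k0)%:R * r * signb R (e x).
Proof.
by rewrite /random_coef valK/=; case: ltnP; rewrite ?mul1r ?mul0r//; case: x.
Qed.

Lemma random_coef_supp r k0 e k j : (K <= k)%N -> random_coef r k0 e k j = 0.
Proof.
move=> Kk; rewrite /random_coef insubF ?mulr0 ?if_same//.
by apply/negbTE; rewrite -leqNgt.
Qed.

Lemma sum_initial_cells k : (k <= K)%N ->
  \sum_(x : cell) (x.1 < k)%:R = (k * p)%:R :> R.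
Proof.
move=> kK; rewrite -(pair_big xpredT xpredT (fun (a : 'I_K) (j : 'I_p) => (a < k)%:R))/=.
under eq_bigr do rewrite sumr_const card_ord.
rewrite sumrMnl -(big_mkord xpredT (fun a => (a < k)%:R)) (@big_cat_nat _ _ _ k)//=.
rewrite [X in X + _](eq_big_nat _ _ (F2 := fun=> 1)) => [|a /andP[_ ->]//].
rewrite sumr_const_nat subn0 big_nat big1 => [|a /andP[ka _]]; last by rewrite ltnNge ka.
by rewrite addr0 natrM mulr_natr.
Qed.

Lemma inner_random_coef r1 k1 e1 r2 k2 e2 :
  inner (leb_cube R p) (signal psi K (random_coef r1 k1 e1))
                       (signal psi K (random_coef r2 k2 e2)) =
  \sum_(x : cell) ((x.1 < minn k1 k2)%:R * r1 * r2 * signb R (e2 x)) * signb R (e1 x).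
Proof.
rewrite inner_signal//; apply: eq_bigr => x _; rewrite !random_coefE.
by rewrite leq_min; case: (_ < k1)%N; case: (_ < k2)%N; rewrite /=; ring.
Qed.

Lemma inner_random_coef_diag r k0 e : (k0 <= K)%N ->
  inner (leb_cube R p) (signal psi K (random_coef r k0 e))
                       (signal psi K (random_coef r k0 e)) = r ^+ 2 * (k0 * p)%:R.
Proof.
move=> k0K; rewrite inner_random_coef minnn -sum_initial_cells// mulr_sumr.
by apply: eq_bigr => x _; have := signb_sqr R (e x); rewrite expr2 -!mulrA => ->; ring.
Qed.

(** Given the second draw, the inner product is a combination of the signs of
    the first one, over the frequencies that both draws use. *)
Lemma sum_expR_random_coef n r1 k1 r2 k2 : (k1 <= K)%N ->
  \sum_(e1 : {ffun cell -> bool}) \sum_(e2 : {ffun cell -> bool})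
    expR (n%:R * inner (leb_cube R p) (signal psi K (random_coef r1 k1 e1))
                                      (signal psi K (random_coef r2 k2 e2))) <=
  #|{ffun cell -> bool}|%:R ^+ 2 *
  expR (2 * (n%:R ^+ 2 * r1 ^+ 2 * r2 ^+ 2 * (minn k1 k2 * p)%:R)).
Proof.
move=> k1K; rewrite exchange_big/=.
have nE : #|{ffun cell -> bool}|%:R = 2 ^+ #|{: cell}| :> R.
  by rewrite card_ffun card_bool natrX.
rewrite expr2 -mulrA mulr_natl -sumr_const; apply: ler_sum => e2 _.
under eq_bigr do rewrite inner_random_coef mulr_sumr.
under eq_bigr do under eq_bigr do rewrite mulrA.
apply: le_trans (rademacher_expR _) _; rewrite nE ler_wpM2l ?exprn_ge0// ler_expR.
rewrite ler_wpM2l// -sum_initial_cells; last by rewrite geq_min k1K.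
rewrite mulr_sumr le_eqVlt; apply/orP; left; apply/eqP; apply: eq_bigr => x _.
rewrite !exprMn signb_sqr; case: (_ < _)%N; rewrite ?expr1n ?expr0n/=; ring.
Qed.

End rademacher_signals.

(** * The scales visited by the unknown smoothness *)

Section scales.
Variable R : realType.

Lemma gt0_powRE (a x : R) : 0 < a -> a `^ x = expR (x * ln a).
Proof. by move=> a0; rewrite /powR gt_eqF. Qed.

Lemma gt0_lnK (x : R) : 0 < x -> expR (ln x) = x.
Proof. by move=> x0; rewrite lnK// posrE. Qed.

Lemma ln2_gt0 : 0 < ln 2 :> R. Proof. by rewrite ln_gt0// ltr1n. Qed.

(** The quantity [N ^ (1 / (4 alpha + 1))] decreases continuously in [alpha], so
    it takes as value every power of two between its extremes, and there are
    about [ln N] of these. *)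
Lemma smoothness_grid (alpha0 alpha1 N : R) : 0 < alpha0 < alpha1 -> 0 < N ->
  let w := (4 * alpha0 + 1)^-1 - (4 * alpha1 + 1)^-1 in
  ln 2 <= w * ln N ->
  exists M m0 (alpha : nat -> R), [/\ (0 < M)%N, w * ln N <= 2 * ln 2 * M%:R &
    forall i, (i < M)%N -> let m : R := (m0 + i)%:R in
      [/\ alpha0 <= alpha i <= alpha1, 2 `^ (m * (4 * alpha i + 1)) = N &
          N `^ (4 * alpha i + 1)^-1 = 2 `^ m]].
Proof.
move=> /andP[a0 a01] N0 w wN.
have l2 := ln2_gt0.
pose A := (4 * alpha1 + 1)^-1; pose B := (4 * alpha0 + 1)^-1.
have A0 : 0 < A by rewrite invr_gt0; lra.
have AB : A < B by rewrite ltf_pV2 ?posrE; lra.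
have w0 : 0 < w by rewrite subr_gt0.
pose l := ln N / ln 2.
have lN : ln N = l * ln 2 by rewrite divfK// gt_eqF.
have lw : 1 <= l * w by move: wN; rewrite lN mulrCA mulrA ler_pMl// mulrC.
have l0 : 0 < l by rewrite -(pmulr_lgt0 _ w0); lra.
(* the M consecutive integers from m0 on lie between l A and
   l B = l A + l w *)
pose M := Num.truncn (l * w); pose m0 := (Num.truncn (l * A)).+1.
have M0 : (0 < M)%N by rewrite truncn_gt0.
have /andP[Mle Mgt] : M%:R <= l * w < M.+1%:R by apply: truncn_itv; lra.
have /andP[mle mgt] : (Num.truncn (l * A))%:R <= l * A < m0%:R.
  by apply: truncn_itv; rewrite mulr_ge0// ltW.
exists M, m0, (fun i => (l / (m0 + i)%:R - 1) / 4); split => //.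
  have M1 : 1 <= M%:R :> R by rewrite ler1n.
  rewrite lN; move: Mgt; rewrite -natr1 => Mgt.
  have : l * w <= 2 * M%:R by lra.
  by rewrite -(ler_pM2r l2); lra.
move=> i iM m.
have mA : l * A < m.
  by apply: lt_le_trans mgt _; rewrite ler_nat leq_addr.
have mB : m <= l * B.
  have : m <= (Num.truncn (l * A))%:R + M%:R.
    by rewrite -natrD ler_nat /m0 addSnnS leq_add2l.
  by move: Mle mle; rewrite /w -/A -/B mulrBr; lra.
have m_gt0 : 0 < m.
  by apply: (lt_trans _ mA); rewrite mulr_gt0.
have aE x : 4 * ((x - 1) / 4) + 1 = x :> R by field.
have lower : 4 * alpha0 + 1 <= l / m.
  rewrite ler_pdivlMr// mulrC -ler_pdivlMr//; lra.
have upper : l / m <= 4 * alpha1 + 1.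
  rewrite ler_pdivrMr// mulrC -ler_pdivrMr ?ltW//; lra.
split.
- by apply/andP; split; lra.
- by rewrite aE mulrCA divff ?gt_eqF// mulr1 gt0_powRE// -lN lnK.
- rewrite aE !gt0_powRE// lN invf_div; congr expR.
  by rewrite mulrA divfK// gt_eqF.
Qed.

Lemma ler_ln_half (x : R) : 0 < x -> ln x <= x / 2.
Proof.
move=> x0.
have xE : x = expR (ln x / 2) ^+ 2.
  by rewrite -{1}(gt0_lnK x0) expr2 -expRD; congr expR; field.
have := expR_ge1Dx (ln x / 2); have := expR_gt0 (ln x / 2).
move: xE; move: (expR _) => e; move: (ln x) => y -> e0 ye.
by have := sqr_ge0 (e - 2); nra.
Qed.

Lemma loglog_gt0 (C x : R) : 0 < C -> 0 < loglog C x.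
Proof.
move=> C0; rewrite /loglog; have [//|h] := ltP (ln (ln x)) 1.
by apply: lt_le_trans h.
Qed.

(** The grid meets the last two conditions with equality, and its number of
    points is of the order of [ln N], hence of [ln (n p)] and of [expR L]. When
    it has no point, [N] and [n p] are bounded and the single scale [0]
    suffices: the constant [B] is for this case. *)
Lemma adaptive_scales (C alpha0 alpha1 : R) : 0 < C -> 0 < alpha0 < alpha1 ->
  exists B G : R, [/\ 1 <= B, 1 <= G & forall p n : nat, (0 < p)%N -> (0 < n)%N ->
    let L := loglog C (n * p)%:R in
    let N := n%:R * p%:R / Num.sqrt (p%:R * L) in
    exists M m0 (alpha : nat -> R), [/\ (0 < M)%N, expR L <= G * M%:R &
      forall i, (i < M)%N -> let m : R := (m0 + i)%:R in
        [/\ alpha0 <= alpha i <= alpha1, 2 `^ (m * (4 * alpha i + 1)) <= B * N &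
            N `^ (4 * alpha i + 1)^-1 <= B * 2 `^ m]]].
Proof.
move=> C0 /[dup] aa /andP[a0 a01].
have l2 := ln2_gt0.
pose w := (4 * alpha0 + 1)^-1 - (4 * alpha1 + 1)^-1.
have w0 : 0 < w by rewrite subr_gt0 ltf_pV2 ?posrE; lra.
pose c1 := Num.sqrt C; pose c2 := expR (expR 1) / Num.sqrt C.
pose c3 := expR (ln 2 / w); pose g := 8 * ln 2 / w.
have c10 : 0 < c1 by rewrite sqrtr_gt0.
have c20 : 0 < c2 by rewrite divr_gt0 ?expR_gt0 ?sqrtr_gt0.
have c30 : 0 < c3 by exact: expR_gt0.
have g0 : 0 < g by rewrite divr_gt0// mulr_gt0.
have eC := expR_gt0 C.
pose B := 1 + c1 + c2 + c3; pose G := 1 + expR C + g.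
have B1 : 1 <= B by rewrite /B; lra.
exists B, G; split => //; first by rewrite /G; lra.
move=> p n p0 n0 L N.
have L0 : 0 < L by exact: loglog_gt0.
have pR : 0 < p%:R :> R by rewrite ltr0n.
have nR : 0 < n%:R :> R by rewrite ltr0n.
have N0 : 0 < N by rewrite divr_gt0 ?mulr_gt0// sqrtr_gt0 mulr_gt0.
have NE : N = n%:R * Num.sqrt p%:R / Num.sqrt L.
  rewrite /N sqrtrM ?ltW// -{1}[p%:R](@sqr_sqrtr _ p%:R) ?ltW//; field.
  by rewrite !gt_eqF ?sqrtr_gt0.
have single : 1 <= B * N -> N <= B -> expR L <= G ->
    exists M m0 (alpha : nat -> R), [/\ (0 < M)%N, expR L <= G * M%:R &
      forall i, (i < M)%N -> let m : R := (m0 + i)%:R in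
        [/\ alpha0 <= alpha i <= alpha1, 2 `^ (m * (4 * alpha i + 1)) <= B * N &
            N `^ (4 * alpha i + 1)^-1 <= B * 2 `^ m]].
  move=> BN NB LG; exists 1%N, 0%N, (fun=> alpha0); split => //; first by rewrite mulr1.
  move=> [|//] _ m; rewrite /m addn0 mul0r !powRr0 mulr1; split => //.
    by apply/andP; split => //; exact: ltW.
  have b1 : 0 <= (4 * alpha0 + 1)^-1 <= 1.
    by apply/andP; split; [rewrite invr_ge0; lra|rewrite invf_le1; lra].
  have /andP[b0 b1'] := b1.
  rewrite gt0_powRE//; have [N1|N1] := lerP 1 N.
    apply: le_trans NB; rewrite -[leRHS](gt0_lnK N0) ler_expR.
    by rewrite ler_piMl// ln_ge0.
  apply: le_trans B1; rewrite -[leRHS]expR0 ler_expR.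
  by rewrite mulr_ge0_le0// ln_le0// ltW.
pose l := ln (n * p)%:R : R.
have np1 : 1 <= (n * p)%:R :> R by rewrite ler1n muln_gt0 n0.
have lE : l = ln n%:R + ln p%:R by rewrite /l natrM lnM ?posrE.
have [lll|lll] := ltP (ln l) 1.
  have LC : L = C by rewrite /L /loglog -/l lll.
  have p1 : 1 <= Num.sqrt p%:R :> R by rewrite -[leLHS]sqrtr1 ler_sqrt// ler1n.
  have n1 : 1 <= n%:R :> R by rewrite ler1n.
  apply: single.
  - rewrite NE LC; apply: (@le_trans _ _ (c1 * (1 / Num.sqrt C))).
      by rewrite /c1 mulrA mulr1 divff// gt_eqF.
    apply: ler_pM; [exact: ltW|by rewrite divr_ge0|by rewrite /B; lra|].
    by rewrite ler_pM2r ?invr_gt0// -[leLHS]mul1r ler_pM.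
  - apply: (@le_trans _ _ c2); last by rewrite /B; lra.
    rewrite NE LC ler_pM2r ?invr_gt0//.
    apply: (@le_trans _ _ (n * p)%:R).
      rewrite natrM ler_pM2l//.
      have : Num.sqrt p%:R ^+ 2 = p%:R :> R by rewrite sqr_sqrtr// ltW.
      by move: p1; move: (Num.sqrt _) => q q1 <-; nra.
    rewrite -[leLHS](gt0_lnK (lt_le_trans ltr01 np1)) ler_expR -/l.
    have [l0|l0] := lerP l 0; first by rewrite (le_trans l0)// expR_ge0.
    by rewrite -[leLHS](gt0_lnK l0) ler_expR ltW.
  - by rewrite LC /G; lra.
have LE : L = ln l by rewrite /L /loglog -/l ltNge lll.
have l0 : 0 < l by rewrite ltNge; apply: contraTN lll => /ln0 ->; rewrite -ltNge.
have lnN : l / 4 <= ln N.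
  have lnp0 : 0 <= ln p%:R :> R by rewrite ln_ge0// ler1n.
  have lnn0 : 0 <= ln n%:R :> R by rewrite ln_ge0// ler1n.
  have sqrtE (x : R) : 0 < x -> ln (Num.sqrt x) = ln x / 2.
    move=> x0; rewrite -[in RHS](@sqr_sqrtr _ x) ?ltW// lnXn ?sqrtr_gt0//.
    by rewrite -mulr_natr; field.
  rewrite NE ln_div ?posrE ?mulr_gt0 ?sqrtr_gt0// lnM ?posrE ?sqrtr_gt0//.
  rewrite !sqrtE//.
  have h1 : ln L <= L by exact/ltW/ln_sublinear.
  have h2 : L <= l / 2 by rewrite LE; exact: ler_ln_half.
  by rewrite lE in h2 *; lra.
have N1 : 1 <= N.
  by rewrite -[leLHS]expR0 -[leRHS](gt0_lnK N0) ler_expR; lra.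
have eL : expR L = l by rewrite LE lnK.
have [wN|wN] := lerP (ln 2) (w * ln N); last first.
  have lnNw : ln N < ln 2 / w by rewrite ltr_pdivlMr// mulrC.
  apply: single.
  - by rewrite -[leLHS]mul1r ler_pM.
  - apply: (@le_trans _ _ c3); last by rewrite /B; lra.
    by rewrite -[leLHS](gt0_lnK N0) ler_expR ltW.
  - rewrite eL; have : l <= g.
      by rewrite /g -mulrA; have := divr_gt0 l2 w0; lra.
    by rewrite /G; lra.
have [M [m0 [alpha [M0 wM H]]]] := smoothness_grid aa N0 wN.
exists M, m0, alpha; split => //.
  have M1 : 1 <= M%:R :> R by rewrite ler1n.
  rewrite eL; apply: (@le_trans _ _ (g * M%:R)); last by rewrite ler_pM2r /G; lra.
  rewrite /g mulrAC ler_pdivlMr//.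
  have : l * w <= 4 * ln N * w by rewrite ler_pM2r//; lra.
  by rewrite -/w in wM; lra.
move=> i iM m; have [aok E1 E2] := H i iM; split => //.
  by rewrite E1 -[leLHS]mul1r ler_pM// ltW.
by rewrite E2 -[leLHS]mul1r ler_pM// powR_ge0.
Qed.
End scales.

(** * The prior *)

Section random_coef_class.
Variables (R : realType) (p K : nat).

Lemma random_coef_sqr_le r k0 (e : {ffun 'I_K * 'I_p -> bool}) k j :
  random_coef r k0 e k j ^+ 2 <= (k < k0)%:R * r ^+ 2 :> R.
Proof.
rewrite /random_coef; case: ltnP => _; last by rewrite expr0n mul0r.
rewrite mul1r exprMn ler_piMr ?sqr_ge0//.
by case: insub => [k'|] /=; rewrite ?signb_sqr ?expr0n.
Qed.

Lemma sum_ltn_le m k0 : (\sum_(0 <= k < m) (k < k0) <= k0)%N.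
Proof.
suff : (\sum_(0 <= k < m) (k < k0) <= minn m k0)%N.
  by move=> /leq_trans; apply; exact: geq_minr.
elim: m => [|m IH]; first by rewrite big_nil.
rewrite big_nat_recr//=; apply: leq_trans (leq_add IH (leqnn _)) _.
by case: ltnP => mk /=; lia.
Qed.

(** Each of the [k0] terms of the Sobolev sum is bounded with the weight of
    frequency [k0]. *)
Lemma random_coef_class r k0 (e : {ffun 'I_K * 'I_p -> bool}) (alpha : R) :
  0 <= alpha -> r ^+ 2 * k0%:R * k0%:R `^ (2 * alpha) <= 1 ->
  coef_class p alpha (random_coef r k0 e).
Proof.
move=> a0 H; split; first by rewrite (leq_trans (max_card _))// card_ord.
move=> j; apply: lime_le.
  apply: is_cvg_nneseries => k _ _.
  by rewrite lee_fin divr_ge0 ?sqr_ge0// powR_ge0.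
apply: nearW => m; rewrite sumEFin lee_fin; apply: le_trans H.
apply: (@le_trans _ _ (\sum_(0 <= k < m) (k < k0)%:R * (r ^+ 2 * k0%:R `^ (2 * alpha)))).
  apply: ler_sum => k _.
  apply: le_trans (ler_wpM2r _ (random_coef_sqr_le _ _ _ _ _)) _.
    by rewrite invr_ge0 powR_ge0.
  case: ltnP => kk; last by rewrite !mul0r.
  rewrite !mul1r ler_wpM2l ?sqr_ge0// mulNr powRN invrK.
  by apply: ge0_ler_powR; rewrite ?nnegrE ?mulr_ge0 ?ler_nat.
rewrite [leRHS]mulrAC [leRHS]mulrC -mulr_suml.
apply: ler_wpM2r; first by rewrite mulr_ge0 ?sqr_ge0 ?powR_ge0.
by rewrite -natr_sum ler_nat; exact: sum_ltn_le.
Qed.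
End random_coef_class.

(** With [4 ^ m] frequencies of squared amplitude of order [2 ^ - m], the
    variance of the inner product of two draws decays like [2 ^ - gap]. *)
Lemma minn_exp4_gap m i j :
  (minn (4 ^ (m + i)) (4 ^ (m + j)) * 2 ^ gap i j = 2 ^ (m + i) * 2 ^ (m + j))%N.
Proof.
wlog ij : i j / (i <= j)%N.
  move=> H; have [|/ltnW] := leqP i j; first exact: H.
  by move=> /H E; rewrite minnC [RHS]mulnC -E [gap i j]addnC.
rewrite (minn_idPl _) ?leq_exp2l ?leq_add2l//.
rewrite /gap (eqP (ij : (i - j == 0)%N)) add0n (_ : 4 = 2 ^ 2)%N// -expnM -!expnD.
by congr (2 ^ _)%N; lia.
Qed.

Lemma average_le (R : realType) (I : finType) (F : I -> R) (S : \bar R) :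
  (0 < #|I|)%N -> (forall i, (F i)%:E <= S)%E -> ((#|I|%:R^-1 * \sum_i F i)%:E <= S)%E.
Proof.
move=> I0 FS; have [i0 _] : {i | i \in I} by apply/sigW/card_gt0P.
have := FS i0; case: S FS => [s FS _|FS _|FS]; [|exact: leey|by rewrite leeNy_eq].
rewrite lee_fin mulrC ler_pdivrMr ?ltr0n// mulr_natr -sumr_const.
by apply: ler_sum => i _; rewrite -lee_fin.
Qed.

Section lower_bound.
Variables (R : realType) (C alpha0 alpha1 eta c a B G : R).
Hypotheses (C0 : 0 < C) (eta0 : 0 < eta).
Hypotheses (B1 : 1 <= B) (G1 : 1 <= G) (a0 : 0 < a) (aB : a * B <= 1).
Hypotheses (aG : 6 * a ^+ 2 * G <= eta ^+ 2) (a2 : 2 * a ^+ 2 <= 1).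
Hypotheses (c0 : 0 < c) (cB : c ^+ 2 * B <= a).

Variables (p n : nat) (psi : nat -> L2 (leb1 R)).
Hypotheses (p0 : (0 < p)%N) (n0 : (0 < n)%N) (ortho : orthonormal_centered psi).

Local Notation L := (loglog C (n * p)%:R).
Local Notation N := (n%:R * p%:R / Num.sqrt (p%:R * L)).

Variables (M m0 : nat) (alpha : nat -> R).
Hypotheses (M0 : (0 < M)%N) (LM : expR L <= G * M%:R).
Hypothesis scale_ok : forall i, (i < M)%N -> let m : R := (m0 + i)%:R in
  [/\ 0 < alpha i, 2 `^ (m * (4 * alpha i + 1)) <= B * N &
      N `^ (4 * alpha i + 1)^-1 <= B * 2 `^ m].

Let K := (4 ^ (m0 + M))%N.
Let cut i := (4 ^ (m0 + i))%N.
Let amp i : R := Num.sqrt (a / (N * 2 ^+ (m0 + i))).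
Local Notation cell := ('I_K * 'I_p)%type.
Local Notation index := ('I_M * {ffun cell -> bool})%type.

Definition prior_signal (x : index) : L2 (leb_cube R p) :=
  signal psi K (random_coef (amp x.1) (cut x.1) x.2).

Let L0 : 0 < L. Proof. exact: loglog_gt0. Qed.

Let pR : 0 < p%:R :> R. Proof. by rewrite ltr0n. Qed.

Let N0 : 0 < N.
Proof. by rewrite divr_gt0 ?mulr_gt0 ?ltr0n// sqrtr_gt0 mulr_gt0. Qed.

Let N2 : n%:R ^+ 2 * p%:R = L * N ^+ 2.
Proof.
rewrite expr_div_n sqr_sqrtr; last by rewrite mulr_ge0// ltW.
by field; rewrite !gt_eqF.
Qed.

Let cutK (i : 'I_M) : (cut i <= K)%N.
Proof. by rewrite leq_exp2l// leq_add2l ltnW. Qed.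

Let amp2 i : amp i ^+ 2 = a / (N * 2 ^+ (m0 + i)).
Proof. by rewrite sqr_sqrtr// divr_ge0 ?(ltW a0)// mulr_ge0 ?exprn_ge0// ltW. Qed.

Let cutE i : (cut i)%:R = 2 ^+ (m0 + i) * 2 ^+ (m0 + i) :> R.
Proof. by rewrite natrX -exprMn -natrM. Qed.

Lemma inner_prior_signal (x : index) :
  inner (leb_cube R p) (prior_signal x) (prior_signal x) = a * p%:R * 2 ^+ (m0 + x.1) / N.
Proof.
rewrite inner_random_coef_diag// amp2 (natrM _ (cut _)) cutE.
have x0 : 2 ^+ (m0 + x.1) != 0 :> R by rewrite expf_neq0.
move: N0 x0; move: N (2 ^+ _) => N' y N'0 y0.
by field; rewrite y0 gt_eqF.
Qed.

Lemma prior_signal_gt0 (x : index) :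
  0 < inner (leb_cube R p) (prior_signal x) (prior_signal x).
Proof. by rewrite inner_prior_signal divr_gt0// !mulr_gt0// exprn_gt0. Qed.

Lemma prior_signal_class (x : index) : fun_class psi p (alpha x.1) (prior_signal x).
Proof.
have [al0 H _] := scale_ok (ltn_ord x.1).
apply: signal_fun_class; first exact: random_coef_supp.
apply: random_coef_class; first exact: ltW.
rewrite amp2 cutE.
set m : R := (m0 + x.1)%:R in H.
have pw : 2 ^+ (m0 + x.1) = 2 `^ m :> R by rewrite powR_mulrn.
have P0 : 0 < 2 `^ m :> R by rewrite powR_gt0.
apply: le_trans aB; rewrite -(ler_pM2r N0).
have -> : a * B * N = a * (B * N) by rewrite mulrA.
apply: le_trans (ler_wpM2l (ltW a0) H).
rewrite pw le_eqVlt; apply/orP; left; apply/eqP.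
have -> : 2 `^ (m * (4 * alpha x.1 + 1)) = 2 `^ m * (2 `^ m * 2 `^ m) `^ (2 * alpha x.1).
  rewrite !gt0_powRE ?mulr_gt0 ?expR_gt0// lnM ?posrE ?expR_gt0// expRK -expRD.
  by congr expR; ring.
move: N0 P0; move: N (2 `^ m) => N' y N'0 y0.
by field; rewrite !gt_eqF.
Qed.

Lemma prior_signal_norm (x : index) :
  ((c * tau_dense C p p n (alpha x.1))%:E <= norm2 (leb_cube R p) (prior_signal x))%E.
Proof.
have [al0 _ H] := scale_ok (ltn_ord x.1).
rewrite norm2_L2 inner_prior_signal lee_fin.
rewrite -[c in leLHS](ger0_norm (ltW c0)) -sqrtr_sqr /tau_dense -sqrtrM ?sqr_ge0//.
apply: ler_wsqrtr; rewrite /tau_dense_sq.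
set be := 4 * alpha x.1 + 1 in H *.
have be0 : 0 < be by rewrite /be; lra.
have -> : - (4 * alpha x.1 / be) = be^-1 - 1.
  by rewrite /be; field; rewrite gt_eqF.
have -> : N `^ (be^-1 - 1) = N `^ be^-1 / N.
  by rewrite !gt0_powRE// mulrBl mul1r expRB lnK ?posrE.
rewrite !mulrA ler_pM2r ?invr_gt0// mulrAC [leRHS]mulrAC ler_pM2r//.
apply: le_trans (ler_wpM2l (sqr_ge0 c) H) _.
rewrite powR_mulrn// mulrA ler_wpM2r// exprn_ge0//.
Qed.

(** The iterated logarithm enters through [n ^ 2 p = L N ^ 2]; the resulting
    [expR (2 a ^ 2 L)] is lowered to a multiple of [expR L] by [expR_chord],
    and [expR L] is at most of the order of the number of scales. *)
Lemma prior_chi2 :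
  \sum_(x : index) \sum_(y : index)
    expR (n%:R * inner (leb_cube R p) (prior_signal x) (prior_signal y)) <=
  #|{: index}|%:R ^+ 2 * (1 + eta ^+ 2).
Proof.
set F : R := #|{ffun cell -> bool}|%:R.
have I2 : #|{: index}|%:R ^+ 2 = M%:R ^+ 2 * F ^+ 2 :> R.
  by rewrite card_prod card_ord natrM exprMn.
apply: (@le_trans _ _ (\sum_(i < M) \sum_(j < M)
    (F ^+ 2 * expR (2 * a ^+ 2 * L * 2^-1 ^+ gap i j)))).
  rewrite -(pair_big xpredT xpredT (fun (i : 'I_M) (e : {ffun cell -> bool}) =>
    \sum_(y : index) expR (n%:R * inner (leb_cube R p) (prior_signal (i, e)) (prior_signal y))))/=.
  apply: ler_sum => i _.
  under eq_bigr => e _.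
    rewrite -(pair_big xpredT xpredT (fun (j : 'I_M) (e' : {ffun cell -> bool}) =>
      expR (n%:R * inner (leb_cube R p) (prior_signal (i, e)) (prior_signal (j, e')))))/=.
    over.
  rewrite exchange_big/=; apply: ler_sum => j _.
  apply: le_trans (sum_expR_random_coef p ortho n (amp i) (amp j) (cut j) (cutK i)) _.
  rewrite ler_wpM2l ?sqr_ge0// ler_expR le_eqVlt; apply/orP; left; apply/eqP.
  rewrite !amp2 (natrM _ (minn _ _)).
  have mE : (minn (cut i) (cut j))%:R * 2 ^+ gap i j =
      2 ^+ (m0 + i) * 2 ^+ (m0 + j) :> R.
    by rewrite -!natrX -!natrM; congr _%:R; exact: minn_exp4_gap.
  have d0 : 2 ^+ gap i j != 0 :> R by rewrite expf_neq0.
  have x0 : 2 ^+ (m0 + i) != 0 :> R by rewrite expf_neq0.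
  have y0 : 2 ^+ (m0 + j) != 0 :> R by rewrite expf_neq0.
  have -> : (minn (cut i) (cut j))%:R = 2 ^+ (m0 + i) * 2 ^+ (m0 + j) / 2 ^+ gap i j :> R.
    by rewrite -mE mulfK.
  rewrite exprVn.
  have NE := N2; have N0' : N != 0 by rewrite gt_eqF.
  move: NE N0'; move: N => N' NE N0'.
  move: d0 x0 y0; move: (2 ^+ gap i j) (2 ^+ (m0 + i)) (2 ^+ (m0 + j)) => dd xx yy d0 x0 y0.
  transitivity (2 * a ^+ 2 * (n%:R ^+ 2 * p%:R) / (N' ^+ 2 * dd)).
    by field; rewrite d0 x0 y0 N0'.
  by rewrite NE; field; rewrite d0 N0'.
under eq_bigr do rewrite -mulr_sumr.
rewrite -mulr_sumr I2 mulrC [leRHS]mulrAC; apply: ler_wpM2r; first by rewrite sqr_ge0.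
apply: le_trans (sum_expR_gap _ _) _; first by rewrite !mulr_ge0 ?sqr_ge0// ltW.
have M1 : 0 < M%:R :> R by rewrite ltr0n.
have e1 : expR (2 * a ^+ 2 * L) <= 1 + 2 * a ^+ 2 * (expR L - 1).
  by apply: expR_chord; rewrite mulr_ge0 ?sqr_ge0.
have e2 : expR (2 * a ^+ 2 * L) - 1 <= 2 * a ^+ 2 * G * M%:R.
  have x0 : 0 <= 2 * a ^+ 2 by rewrite mulr_ge0// sqr_ge0.
  by have := ler_wpM2l x0 LM; move: x0 e1; move: (2 * a ^+ 2) => x; lra.
rewrite [leRHS]mulrDr mulr1 lerD2l.
apply: le_trans (ler_wpM2l _ e2) _; first by rewrite mulr_ge0// ltW.
have -> : 3 * M%:R * (2 * a ^+ 2 * G * M%:R) = M%:R ^+ 2 * (6 * a ^+ 2 * G) by ring.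
by rewrite ler_wpM2l// sqr_ge0.
Qed.
End lower_bound.

(** * The lower bound *)

Theorem theorem5 (R : realType) (C delta alpha0 alpha1 eta : R)
    (hC : 0 < C) (hdelta : 0 < delta < 2^-1)
    (halpha : 0 < alpha0 < alpha1) (heta : 0 < eta < 1) :
  exists c_eta : R, 0 < c_eta /\
    forall (p n : nat) (psi : nat -> L2 (leb1 R))
      (d : measure_display) (Omega : measurableType d) (P : probability Omega R)
      (W : L2 (leb_cube R p) -> {RV P >-> R}) (c : R),
      (0 < p)%N -> (0 < n)%N -> orthonormal_centered psi -> is_white_noise W ->
      0 < c < c_eta ->
      ((1 - eta)%:E <= minimax_risk C n psi W delta alpha0 alpha1 c)%E.
Proof.
have /andP[eta0 eta1] := heta.
have [B [G [B1 G1 scales]]] := adaptive_scales hC halpha.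
have B0 : 0 < B by exact: lt_le_trans B1.
have G0 : 0 < G by exact: lt_le_trans G1.
(* the factor 3 leaves room for 6 a ^ 2 G <= eta ^ 2 and 2 a ^ 2 <= 1 *)
pose a := eta / (3 * B * G).
have a0 : 0 < a by rewrite divr_gt0// !mulr_gt0.
have aBG : a * B * G * 3 = eta by rewrite /a; field; rewrite !gt_eqF.
have BG1 : 1 <= B * G by nra.
have aB : a * B <= 1 by have := mulr_gt0 a0 B0; nra.
have a1 : a * 3 <= 1 by have := mulr_gt0 a0 B0; nra.
have aG : 6 * a ^+ 2 * G <= eta ^+ 2.
  have BBG : 1 <= B ^+ 2 * G by nra.
  have -> : eta ^+ 2 = 9 * (a ^+ 2 * G) * (B ^+ 2 * G) by rewrite -aBG; ring.
  have : 0 <= a ^+ 2 * G by rewrite mulr_ge0 ?sqr_ge0// ltW.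
  by nra.
have a2 : 2 * a ^+ 2 <= 1 by nra.
(* the draws have squared norm at least (a / B) tau ^ 2 *)
exists (Num.sqrt (a / B)); split; first by rewrite sqrtr_gt0 divr_gt0.
move=> p n psi d Omega P W c p0 n0 ortho white /andP[c0 cle].
have cB : c ^+ 2 * B <= a.
  have aB0 : 0 < a / B by rewrite divr_gt0.
  rewrite -ler_pdivlMr// -[leRHS]sqr_sqrtr; last exact: ltW.
  by have := sqrtr_ge0 (a / B); nra.
have [M [m0 [alpha [M0 LM grid]]]] := scales p n p0 n0.
have scale_ok i (iM : (i < M)%N) : let m : R := (m0 + i)%:R in
    [/\ 0 < alpha i, 2 `^ (m * (4 * alpha i + 1)) <=
          B * (n%:R * p%:R / Num.sqrt (p%:R * loglog C (n * p)%:R)) &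
        (n%:R * p%:R / Num.sqrt (p%:R * loglog C (n * p)%:R)) `^ (4 * alpha i + 1)^-1
          <= B * 2 `^ m].
  have [/andP[al _] H1 H2] := grid i iM; split => //.
  by apply: lt_le_trans al; case/andP: halpha.
pose cell := ('I_(4 ^ (m0 + M)) * 'I_p)%type.
pose index := ('I_M * {ffun cell -> bool})%type.
pose f (x : index) := prior_signal C a n psi x : L2 (leb_cube R p).
have index0 : (0 < #|{: index}|)%N.
  by rewrite card_prod card_ord muln_gt0 M0 card_ffun card_bool expn_gt0.
have f0 x : 0 < inner (leb_cube R p) (f x) (f x) by exact: prior_signal_gt0.
apply: le_ereal_inf_tmp => _ [phi _ <-].
pose A := [set y : obs R p | phi y <> true].
have mA : measurable A.
  rewrite (_ : A = phi @^-1` [set b | b <> true])//.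
  by rewrite -[X in measurable X]setTI; exact: (measurable_funPT phi).
have AC : [set y | phi y <> false] = ~` A.
  apply/seteqP; split=> y; rewrite /A /=; case: (phi y) => // H.
    by move=> /(_ erefl).
have chi2 := prior_chi2 hC a0 aG a2 p0 n0 ortho m0 M0 LM.
have bound := mixture_testing_bound white n0 f0 eta0 index0 chi2 mA.
rewrite /risk AC.
apply: (@le_trans _ _ ((fine (law W n (null_signal R p) (~` A)))%:E +
    (#|{: index}|%:R^-1 * \sum_x fine (law W n (f x) A))%:E)%E).
  by rewrite -EFinD lee_fin.
rewrite fineK ?fin_num_measure//; last exact: measurableC.
rewrite leeD2l//; apply: average_le => // x.
rewrite fineK ?fin_num_measure//.
have x_class : fun_class psi p (alpha x.1) (f x).
  exact: (prior_signal_class hC a0 aB psi p0 n0 scale_ok).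
have x_norm : ((c * tau_dense C p p n (alpha x.1))%:E <= norm2 (leb_cube R p) (f x))%E.
  exact: (prior_signal_norm hC a0 c0 cB p0 n0 ortho scale_ok).
pose signals s al := [set g : L2 (leb_cube R p) | fun_class psi s al g /\
  ((c * tau_dense C p s n al)%:E <= norm2 (leb_cube R p) g)%E].
pose over_signals s al := ereal_sup [set law W n g A | g in signals s al].
pose over_smoothness s := ereal_sup [set over_signals s al | al in [set` `[alpha0, alpha1]]].
apply: (@le_trans _ _ (over_signals p (alpha x.1))).
  by apply: ereal_sup_ubound; exists (f x).
apply: (@le_trans _ _ (over_smoothness p)).
  apply: ereal_sup_ubound; exists (alpha x.1) => //=.
  by rewrite in_itv/=; case: (grid x.1 (ltn_ord x.1)).
apply: ereal_sup_ubound; exists p => //; split; first by rewrite p0 leqnn.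
rewrite -[leRHS]powRr1 ?ler0n//; apply: ler_powR; first by rewrite ler1n.
by case/andP: hdelta => _ d2; lra.
Qed.
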